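(* Let $p\in[1,\infty]$, let $E$ and $L$ be locally convex spaces, and let $T:E\to L$ be an operator (continuous linear map). Consider the following assertions: (i) $T$ is weak$^\ast$ $p$-convergent; (ii) $T$ maps every (non-empty) weakly sequentially $p$-precompact subset of $E$ to a limited subset of $L$; (iii) $T$ maps every (non-empty) relatively weakly sequentially $p$-compact subset of $E$ to a limited subset of $L$; (iii$'$) $T$ maps every (non-empty) weakly sequentially $p$-compact subset of $E$ to a limited subset of $L$; (iv) $T$ maps (the range of) every weakly $p$-summable sequence of $E$ to a limited subset of $L$; (v) $S\circ T$ is $p$-convergent for every locally convex space $Z$ such that for every neighborhood $U$ of zero in $Z$ the polar $U^\circ\subseteq Z'$ is selectively sequentially pseudocompact in the weak$^\ast$ topology, and every $S\in\mathcal{L}(L,Z)$; (v$'$) the same as (v), but only for Banach spaces $Z$ with the stated property; (vi) $S\circ T$ is $p$-convergent for every $S\in\mathcal{L}(L,c_0)$; (vii) for every normed space $X$ and every weakly sequentially $p$-precompact operator $R:X\to E$, the operator $T\circ R$ is limited; (viii) for every normed space $X$ and every weakly sequentially $p$-precompact operator $R:X\to E$, the linear map $R^\ast\circ T^\ast: L'_{w^\ast}\to X'_\beta$ is $\infty$-convergent; (ix) if $R\in\mathcal{L}(\ell_1^0,E)$ is weakly sequentially $p$-precompact, then $T\circ R$ is limited; (x) for every normed space $Z$ and every weakly sequentially $p$-compact operator $S:Z\to E$, the composition $T\circ S$ is limited; (xi) for every $S\in\mathcal{L}(\ell_{p^\ast},E)$, the map $T\circ S$ is limited. Then: (A) (i)$\Leftrightarrow$(ii)$\Leftrightarrow$(iii)$\Leftrightarrow$(iii$'$)$\Leftrightarrow$(iv);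 (B) (i)$\Rightarrow$(v)$\Leftrightarrow$(v$'$)$\Rightarrow$(vi), and if $L$ is $c_0$-barrelled, then (vi)$\Rightarrow$(i); (C) (ii)$\Rightarrow$(vii)$\Leftrightarrow$(viii)$\Rightarrow$(ix), and if $E$ is weakly sequentially locally $p$-complete, then (ix)$\Rightarrow$(i); (D) if $1<p<\infty$, then (iii)$\Rightarrow$(x)$\Rightarrow$(xi), and if moreover $E$ is sequentially complete, then (xi)$\Rightarrow$(i).
   Context: All locally convex spaces are Hausdorff and over the field $\mathbb{F}\in\{\mathbb{R},\mathbb{C}\}$. ''Operator'' means continuous linear map; $\mathcal{L}(H,L)$ is the set of operators from $H$ to $L$. For a locally convex space $E$: $E'$ is its topological dual; $E'_{w^\ast}$ and $E'_\beta$ are $E'$ with the weak$^\ast$ topology $\sigma(E',E)$ and the strong topology $\beta(E',E)$; $A^\circ=\{\chi\in E':|\chi(x)|\le 1\ \forall x\in A\}$ is the polar of $A\subseteq E$. $T^\ast$ is the adjoint map. $p^\ast$ is defined by $1/p+1/p^\ast=1$. $\ell_1^0$ is the linear span of the canonical unit vectors in $\ell_1$ with the norm induced from $\ell_1$. A sequence $\{x_n\}$ in $E$ is weakly $p$-summable if for every $\chi\in E'$, $(\langle\chi,x_n\rangle)_n\in\ell_p$ if $p<\infty$, and $(\langle\chi,x_n\rangle)_n\in c_0$ if $p=\infty$. It is weakly $p$-convergent to $x\in E$ if $\{x_n-x\}$ is weakly $p$-summable; it is weakly $p$-Cauchy if for each pair of strictly increasing sequences $(k_n),(j_n)$ of natural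 numbers, $(x_{k_n}-x_{j_n})_n$ is weakly $p$-summable. A subset $A\subseteq E$ is (relatively) weakly sequentially $p$-compact if every sequence in $A$ has a weakly $p$-convergent subsequence with limit in $A$ (resp., in $E$); it is weakly sequentially $p$-precompact if every sequence in $A$ has a weakly $p$-Cauchy subsequence. A non-empty $A\subseteq E$ is limited if $\sup_{a\in A}|\langle\chi_n,a\rangle|\to0$ for every weak$^\ast$ null sequence $\{\chi_n\}$ in $E'$. A linear map $T:E\to L$ is: weak$^\ast$ $p$-convergent if $\lim_n\langle\eta_n,T(x_n)\rangle=0$ for every weak$^\ast$ null sequence $\{\eta_n\}$ in $L'$ and every weakly $p$-summable sequence $\{x_n\}$ in $E$; $p$-convergent if it sends weakly $p$-summable sequences of $E$ to null sequences of $L$; weakly sequentially $p$-compact (resp., weakly sequentially $p$-precompact, limited) if there is a neighborhood $U$ of zero in $E$ such that $T(U)$ is a relatively weakly sequentially $p$-compact (resp., weakly sequentially $p$-precompact, limited) subset of $L$. $E$ is $c_0$-barrelled if every $\sigma(E',E)$-null sequence is equicontinuous; sequentially complete if every Cauchy sequence converges; weakly sequentially locally $p$-complete if the closed absolutely convex hull of every weakly $p$-summable sequence in $E$ is weakly sequentially $p$-precompact. A topological space $X$ is selectively sequentially pseudocompact if for every sequence $\{U_n\}$ of non-empty open subsets of $X$ there is $(x_n)\in\prod_n U_n$ containing a subsequence that converges in $X$. *)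

(* Defs.v *)
From HB Require Import structures.
From mathcomp Require Import all_boot all_order all_algebra.
From mathcomp Require Import all_classical all_reals all_analysis ess_sup_inf.
From mathcomp Require Import complex.

Set Implicit Arguments.
Unset Strict Implicit.
Unset Printing Implicit Defensive.
Import Order.TTheory GRing.Theory Num.Theory.
Import numFieldNormedType.Exports.

Local Open Scope classical_set_scope.
Local Open Scope ring_scope.

Definition operator_pred {K : numFieldType} (E L : tvsType K) : {pred E -> L} :=
  fun f => `[< linear f /\ continuous f >].
Arguments operator_pred {K} E L _ /.

Lemma operator_submod_closed {K : numFieldType} (E L : tvsType K) :
  submod_closed (operator_pred E L).
Proof.
split.
  apply/asboolP; split; first by move=> a x y; rewrite /= scaler0 addr0.
  by move=> x; exact: cvg_cst.
move=> c f g /asboolP[lf cf] /asboolP[lg cg]; apply/asboolP; split.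
  move=> a x y /=.
  transitivity (c *: f (a *: x + y) + g (a *: x + y)) => //.
  rewrite lf lg !scalerDr !scalerA (mulrC c a) -!addrA.
  transitivity (a * c *: f x + (c *: f y + (a *: g x + g y))) => //.
  by rewrite [c *: f y + (_ + _)]addrCA -!scalerA.
move=> x; rewrite (_ : c *: f + g =
  (fun z : L * L => z.1 + z.2) \o (fun x => (c *: f x, g x)))//.
apply: continuous_comp; last exact: add_continuous.
apply: cvg_pair; last exact: cg.
apply: (@continuous_comp _ _ _ (fun x => (c : K^o, f x))
    (fun z : K^o * L => z.1 *: z.2)); last exact: scale_continuous.
apply: (@cvg_pair _ _ _ _ (nbhs (c : K^o)) (nbhs (f x)) _ _ _ (fun=> c : K^o) f).
  exact: cvg_cst.
exact: cf.
Qed.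

HB.instance Definition _ (K : numFieldType) (E L : tvsType K) :=
  GRing.isSubmodClosed.Build K (E -> L) (operator_pred E L)
    (operator_submod_closed E L).

Definition operator {K : numFieldType} (E L : tvsType K) : Type :=
  {f : E -> L | f \in operator_pred E L}.

HB.instance Definition _ (K : numFieldType) (E L : tvsType K) :=
  SubChoice.on (operator E L).
HB.instance Definition _ (K : numFieldType) (E L : tvsType K) :=
  [SubChoice_isSubLmodule of operator E L by <:].

Definition operator_fun {K : numFieldType} {E L : tvsType K}
  (T : operator E L) : E -> L := \val T.
Coercion operator_fun : operator >-> Funclass.

Section OperatorTheory.
Context {K : numFieldType}.
Implicit Types E L M : tvsType K.

Lemma operator_linear E L (T : operator E L) : linear T.
Proof. by have /asboolP[] := valP T. Qed.

Lemma operator_continuous E L (T : operator E L) : continuous T.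
Proof. by have /asboolP[] := valP T. Qed.

HB.instance Definition _ E L (T : operator E L) :=
  GRing.isLinear.Build K E L _ (operator_fun T) (operator_linear T).

Lemma operator_ext E L (S T : operator E L) : S =1 T -> S = T.
Proof. by move=> ST; apply/val_inj/funext. Qed.

Lemma operator_mem E L (f : E -> L) :
  linear f -> continuous f -> f \in operator_pred E L.
Proof. by move=> lf cf; apply/asboolP. Qed.

Lemma operator_comp_mem E L M (S : operator L M) (T : operator E L) :
  S \o T \in operator_pred E M.
Proof.
apply: operator_mem => [a x y|x]; first by rewrite /= !linearP.
by apply: continuous_comp; exact: operator_continuous.
Qed.

Definition operator_comp E L M (S : operator L M) (T : operator E L) :
  operator E M := Sub (S \o T) (operator_comp_mem S T).

End OperatorTheory.

Definition dual {K : numFieldType} (E : tvsType K) : Type := operator E K^o.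
HB.instance Definition _ (K : numFieldType) (E : tvsType K) :=
  GRing.Lmodule.on (dual E).
Definition dual_fun {K : numFieldType} {E : tvsType K}
  (f : dual E) : E -> K^o := operator_fun f.
Coercion dual_fun : dual >-> Funclass.

Definition adjoint {K : numFieldType} {E L : tvsType K} (T : operator E L)
  (f : dual L) : dual E := operator_comp f T.

(* A family of subsets of E on which every functional is bounded, directed
   upwards: the polar topologies on the dual are the topologies of uniform
   convergence on the members of such a family. *)
Record polar_family {K : numFieldType} (E : tvsType K) := PolarFamily {
  pf_mem : set (set E) ;
  pf_set0 : pf_mem set0 ;
  pf_setU : forall A B, pf_mem A -> pf_mem B -> pf_mem (A `|` B) ;
  pf_bounded : forall B, pf_mem B -> forall f : dual E,
    exists M : K, forall x, B x -> `|f x| <= M }.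

Definition polar_dual {K : numFieldType} (E : tvsType K)
  (S : polar_family E) : Type := dual E.

HB.instance Definition _ (K : numFieldType) (E : tvsType K)
  (S : polar_family E) := GRing.Lmodule.on (polar_dual S).

Definition polar_dual_fun {K : numFieldType} {E : tvsType K}
  {S : polar_family E} (f : polar_dual S) : E -> K^o := dual_fun f.
Coercion polar_dual_fun : polar_dual >-> Funclass.

Section PolarTopology.
Context {K : numFieldType} {E : tvsType K} (S : polar_family E).
Local Notation V := (polar_dual S).
Implicit Types f g h : V.

Definition polar_entourage : set_system (V * V) := fun A =>
  exists B (e : K), [/\ pf_mem S B, 0 < e &
    forall f g : V, (forall x, B x -> `|f x - g x| <= e) -> A (f, g)].

Let entourage_filter : Filter polar_entourage.
Proof.
split.
- by exists set0, 1; split=> //; exact: pf_set0.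
- move=> P Q [B [e [SB e0 BP]]] [C [d [SC d0 CQ]]].
  exists (B `|` C), (e * d / (e + d)); have ed0 := addr_gt0 e0 d0; split.
  + exact: pf_setU.
  + by rewrite divr_gt0// mulr_gt0.
  + move=> f g fg; split.
    * apply: BP => x Bx; apply: le_trans (fg x (or_introl Bx)) _.
      by rewrite ler_pdivrMr// ler_wpM2l ?ltW// ltrDr.
    * apply: CQ => x Cx; apply: le_trans (fg x (or_intror Cx)) _.
      by rewrite ler_pdivrMr// mulrC ler_wpM2l ?ltW// ltrDl.
- move=> P Q PQ [B [e [SB e0 BP]]]; exists B, e; split=> // f g /BP.
  exact: PQ.
Qed.

Let entourage_diagonal A : polar_entourage A -> diagonal `<=` A.
Proof.
move=> [B [e [SB e0 BA]]] [f g] /= fg; apply: BA => x _.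
have {g fg} -> : g = f by [].
by rewrite subrr normr0 ltW.
Qed.

Let entourage_inv A : polar_entourage A -> polar_entourage A^-1%relation.
Proof.
move=> [B [e [SB e0 BA]]]; exists B, e; split=> // f g fg; apply: BA => x Bx.
by rewrite distrC fg.
Qed.

Let entourage_split A : polar_entourage A ->
  exists2 B, polar_entourage B & (B \; B)%relation `<=` A.
Proof.
move=> [B [e [SB e0 BA]]].
exists [set fg : V * V | forall x, B x -> `|fg.1 x - fg.2 x| <= e / 2].
  by exists B, (e / 2); split=> //; rewrite divr_gt0.
move=> [f g] [h /= fh hg]; apply: BA => x Bx.
rewrite -(subrKA (h x)) (le_trans (ler_normD _ _))// [leRHS]splitr.
by rewrite lerD ?fh ?hg.
Qed.

HB.instance Definition _ := isUniform.Build V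
  entourage_filter entourage_diagonal entourage_inv entourage_split.

Lemma polar_nbhsP f (A : set V) : nbhs f A <->
  exists B (e : K), [/\ pf_mem S B, 0 < e &
    forall g, (forall x, B x -> `|f x - g x| <= e) -> A g].
Proof.
rewrite -nbhs_entourageE; split.
  move=> [U [B [e [SB e0 BU]]] UA]; exists B, e; split=> // g fg.
  by apply: UA; apply/xsectionP; exact: BU.
move=> [B [e [SB e0 BA]]].
exists [set hg : V * V | forall x, B x -> `|hg.1 x - hg.2 x| <= e].
  by exists B, e.
by move=> g /xsectionP/= /BA.
Qed.

Let add_continuous : continuous (fun z : V * V => z.1 + z.2).
Proof.
suff H f g (A : set V) : nbhs (f + g) A ->
    nbhs (f, g) [set z : V * V | A (z.1 + z.2)] by move=> [f g] A /H.
move=> /polar_nbhsP[B [e [SB e0 BA]]].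
have N h : nbhs h [set h' : V | forall x, B x -> `|h x - h' x| <= e / 2].
  by apply/polar_nbhsP; exists B, (e / 2); split=> //; rewrite divr_gt0.
exists ([set f' : V | forall x, B x -> `|f x - f' x| <= e / 2],
        [set g' : V | forall x, B x -> `|g x - g' x| <= e / 2]).
  by split; exact: N.
move=> [f' g'] /= [ff' gg']; apply: BA => x Bx.
rewrite [X in `|X|](_ : _ = (f x - f' x) + (g x - g' x)); last first.
  by rewrite addrACA -opprD.
by rewrite (le_trans (ler_normD _ _))// [leRHS]splitr lerD ?ff' ?gg'.
Qed.

Let scale_continuous : continuous (fun z : K^o * V => z.1 *: z.2).
Proof.
suff H (k : K^o) f (A : set V) : nbhs (k *: f) A ->
    nbhs (k, f) [set z : K^o * V | A (z.1 *: z.2)] by move=> [k f] A /H.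
move=> /polar_nbhsP[B [e [SB e0 BA]]].
have [M0 fM0] := pf_bounded SB f.
pose M : K := `|M0| + 1.
have M_gt0 : 0 < M by rewrite ltr_wpDl.
have fM x : B x -> `|f x| <= M.
  move=> Bx; have fx := fM0 _ Bx.
  have : 0 <= M0 := le_trans (normr_ge0 _) fx.
  move=> M00; apply: le_trans fx _.
  by rewrite /M (ger0_norm M00) lerDl.
pose N : K := `|k| + 1.
have N_gt0 : 0 < N by rewrite ltr_wpDl.
pose d : K := e / 2 / M.
have d_gt0 : 0 < d by rewrite !divr_gt0.
pose d' : K := d / (1 + d).
have d1 : 0 < 1 + d by rewrite addr_gt0.
have d'_gt0 : 0 < d' by rewrite divr_gt0.
have d'd : d' <= d by rewrite ler_pdivrMr// mulrDr mulr1 lerDl mulr_ge0// ltW.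
have d'1 : d' <= 1 by rewrite ler_pdivrMr// mul1r lerDr.
exists (ball (k : K^o) d', [set g : V | forall x, B x -> `|f x - g x| <= e / 2 / N]).
  split=> /=; first exact: nbhsx_ballx.
  by apply/polar_nbhsP; exists B, (e / 2 / N); split=> //; rewrite !divr_gt0.
move=> [l g] /= [kl fg]; apply: BA => x Bx.
rewrite -ball_normE /= in kl.
rewrite [X in `|X|](_ : _ = (k - l) * f x + l * (f x - g x)); last first.
  by rewrite mulrBl mulrBr addrA subrK.
rewrite (le_trans (ler_normD _ _))// [leRHS]splitr !normrM lerD//.
  apply: (@le_trans _ _ (d * M)); last by rewrite /d divfK// gt_eqF.
  by rewrite ler_pM ?fM// (le_trans (ltW kl)).
rewrite (@le_trans _ _ (N * (e / 2 / N)))//; last first.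
  by rewrite mulrC divfK// gt_eqF.
rewrite ler_pM ?fg//.
rewrite -[l](subrK k) (le_trans (ler_normD _ _))// addrC lerD2l distrC.
by rewrite (le_trans (ltW kl)).
Qed.

Let locally_convex : exists2 B : set_system V,
  (forall b, b \in B -> convex_set b) & basis B.
Proof.
pose b f B (e : K) : set V := [set g | exists2 d : K, d < e &
  (0 <= d) /\ forall x, B x -> `|f x - g x| <= d].
exists [set U | exists f B (e : K), [/\ pf_mem S B, 0 < e & U = b f B e]].
  move=> U; rewrite inE => -[f [B [e [SB e0 ->]]]].
  move=> g0 h0 t; pose g : V := g0; pose h : V := h0; rewrite !inE => -[d de [d0 gd]] [c ce [c0 hc]].
  have s0 : 0 <= t%:num :> K by exact: ge0.
  have s1 : 0 <= 1 - t%:num :> K by rewrite subr_ge0; exact: le1.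
  exists (t%:num * d + (1 - t%:num) * c).
    have [->|tn0] := eqVneq (t%:num : K) 0.
      by rewrite mul0r add0r subr0 mul1r.
    rewrite -[ltRHS]mul1r -[X in X * e](subrKC t%:num) [ltRHS]mulrDl ltr_leD//.
      by rewrite ltr_pM2l// lt_neqAle eq_sym tn0 s0.
    by rewrite ler_wpM2l// ltW.
  split=> [|x Bx]; first by rewrite addr_ge0// mulr_ge0.
  rewrite [X in `|X|](_ : _ =
      t%:num * (f x - g x) + (1 - t%:num) * (f x - h x)).
    rewrite (le_trans (ler_normD _ _))// !normrM (ger0_norm s0) (ger0_norm s1).
    by rewrite lerD// ler_wpM2l ?gd ?hc.
  by rewrite !mulrBr addrACA -mulrDl subrKC mul1r -opprD.
split.
  move=> U [f [B [e [SB e0 ->]]]]; rewrite openE => g0; pose g : V := g0; move=> [d de [d0 fg]].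
  rewrite /interior/=.
  apply/polar_nbhsP; exists B, ((e - d) / 2); split=> //.
    by rewrite divr_gt0// subr_gt0.
  move=> h gh; exists (d + (e - d) / 2).
    by rewrite -ltrBrDl gtr_pMr ?subr_gt0// invf_lt1// ltrDl.
  split=> [|x Bx].
    by rewrite addr_ge0// divr_ge0// subr_ge0 ltW.
  rewrite -(subrKA (g x)) (le_trans (ler_normD _ _))//.
  by rewrite lerD ?fg ?gh.
move=> f A /polar_nbhsP[B [e [SB e0 BA]]].
exists (b f B e); first split.
- by exists f, B, e.
- by exists 0 => //; split=> // x _; rewrite subrr normr0.
- move=> g [d de [d0 fg]]; apply: BA => x /fg /le_trans; apply.
  exact: ltW.
Qed.

Lemma polar_cvgP (u : nat -> V) f : u @ \oo --> f <->
  forall B, pf_mem S B -> forall e : K, 0 < e ->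
    \forall n \near \oo, forall x, B x -> `|f x - u n x| <= e.
Proof.
split=> [uf B SB e e0|uf A /polar_nbhsP[B [e [SB e0 BA]]]].
  have := uf [set g : V | forall x, B x -> `|f x - g x| <= e].
  by apply; apply/polar_nbhsP; exists B, e.
have := uf B SB e e0; apply: (@filterS _ (nbhs \oo)) => n fn.
exact: BA.
Qed.

HB.instance Definition _ :=
  PreTopologicalNmodule_isTopologicalNmodule.Build V add_continuous.
HB.instance Definition _ :=
  TopologicalNmodule_isTopologicalLmodule.Build K V scale_continuous.
HB.instance Definition _ := Uniform_isTvs.Build K V locally_convex.

End PolarTopology.

Definition von_neumann_bounded {K : numFieldType} (E : tvsType K)
    (B : set E) : Prop :=
  forall U : set E, nbhs 0 U -> exists2 r : K, 0 < r &
    forall s : K, r <= `|s| -> B `<=` [set s *: u | u in U].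

Section DualTopologies.
Context {K : numFieldType} (E : tvsType K).

Let finite_bounded (B : set E) : finite_set B -> forall f : dual E,
  exists M : K, forall x, B x -> `|f x| <= M.
Proof.
move=> fB f; have [s ->] := (@finite_seqP _ B).1 fB.
exists (\sum_(x <- s) `|f x|) => x /= xs.
rewrite (big_rem x xs)/= lerDl sumr_ge0// => i _; exact: normr_ge0.
Qed.

Let von_neumann_bounded0 : @von_neumann_bounded K E set0.
Proof. by move=> U _; exists 1 => [|s _ x []]; exact: ltr01. Qed.

Let von_neumann_boundedU (A B : set E) : von_neumann_bounded A ->
  von_neumann_bounded B -> von_neumann_bounded (A `|` B).
Proof.
move=> bA bB U U0; have [r r0 rA] := bA U U0; have [t t0 tB] := bB U U0.
exists (r + t) => [|s rts]; first exact: addr_gt0.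
move=> x [/rA|/tB]; apply; apply: le_trans rts.
  by rewrite lerDl ltW.
by rewrite lerDr ltW.
Qed.

Let von_neumann_bounded_dual (B : set E) : von_neumann_bounded B ->
  forall f : dual E, exists M : K, forall x, B x -> `|f x| <= M.
Proof.
move=> bB f.
have f0 : f 0 = 0 by exact: raddf0.
have U0 : nbhs (0 : E) [set x | `|f x| < 1].
  have := @operator_continuous _ _ _ f 0 (ball (f 0 : K^o) 1).
  move=> /(_ (nbhsx_ballx (f 0 : K^o) 1 ltr01)).
  apply: (@filterS _ (nbhs (0 : E))) => x fx.
  have : `|f 0 - f x| < 1 by move: fx; rewrite -ball_normE.
  by rewrite f0 sub0r normrN.
have [r r0 rB] := bB _ U0.
have rr : r <= `|r| by rewrite ger0_norm// ltW.
exists r => x /(rB r rr)[u /= fu <-].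
have -> : f (r *: u) = r * f u by exact: linearZ.
by rewrite normrM (ger0_norm (ltW r0)) ler_piMr// ltW.
Qed.

Let finite_setU_closed (A B : set E) :
  finite_set A -> finite_set B -> finite_set (A `|` B).
Proof. by move=> fA fB; rewrite finite_setU. Qed.

Definition finite_family : polar_family E := @PolarFamily K E
  finite_set (finite_set0 E) finite_setU_closed finite_bounded.

Definition bounded_family : polar_family E := @PolarFamily K E
  (@von_neumann_bounded K E) von_neumann_bounded0 von_neumann_boundedU
  von_neumann_bounded_dual.

End DualTopologies.

Notation weakstar_dual E := (polar_dual (finite_family E)).
Notation strong_dual E := (polar_dual (bounded_family E)).

Lemma weakstar_cvgP {K : numFieldType} {E : tvsType K}
    (u : nat -> weakstar_dual E) (f : weakstar_dual E) :
  u @ \oo --> f <-> forall x : E, u n x @[n --> \oo] --> f x.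
Proof.
rewrite polar_cvgP; split=> [uf x|uf B /finite_seqP[s ->] e e0].
  apply/cvgrPdist_le => e e0.
  have := uf [set x] (finite_set1 x) e e0.
  by apply: (@filterS _ (nbhs \oo)) => n; exact.
elim: s => [|y s IHs]; first by apply: nearW.
have /cvgrPdist_le/(_ e e0) fy := uf y.
near=> n => x /=; rewrite inE => /predU1P[->|xs]; first by near: n.
by move: x xs; near: n.
Unshelve. all: by end_near. Qed.

Definition polar {K : numFieldType} {E : tvsType K} (A : set E) :
  set (weakstar_dual E) := [set f | forall x, A x -> `|f x| <= 1].

Inductive scalar_kind := real_scalars | complex_scalars.

Definition scalars (R : realType) (k : scalar_kind) : numFieldType :=
  match k with real_scalars => R | complex_scalars => R[i] end.

Definition modulus {R : realType} {k : scalar_kind} : scalars R k -> R :=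
  match k with
  | real_scalars => fun x : R => `|x|
  | complex_scalars => fun z : R[i] => complex.Re `|z|
  end.

Definition of_real {R : realType} {k : scalar_kind} : R -> scalars R k :=
  match k with
  | real_scalars => id
  | complex_scalars => fun x : R => x%:C%C
  end.

Section Modulus.
Context {R : realType} {k : scalar_kind}.
Local Notation K := (scalars R k).
Implicit Types (x y : K) (r s : R).

Lemma of_realD r s : of_real (r + s) = of_real r + of_real s :> K.
Proof. by case: k => //=; rewrite rmorphD. Qed.

Lemma of_realM r s : of_real (r * s) = of_real r * of_real s :> K.
Proof. by case: k => //=; rewrite rmorphM. Qed.

Lemma of_real0 : of_real 0 = 0 :> K.
Proof. by case: k. Qed.

Lemma ler_of_real r s : (of_real r <= of_real s :> K) = (r <= s).
Proof. by case: k => //=; rewrite lecR. Qed.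

Lemma of_real_inj : injective (of_real : R -> K).
Proof. by case: k => //= r s []. Qed.

Lemma modulusE x : of_real (modulus x) = `|x|.
Proof. by case: k x. Qed.

Lemma modulus_ge0 x : 0 <= modulus x.
Proof. by rewrite -ler_of_real of_real0 modulusE. Qed.

Lemma ler_modulusD x y : modulus (x + y) <= modulus x + modulus y.
Proof. by rewrite -ler_of_real of_realD !modulusE ler_normD. Qed.

Lemma modulusM x y : modulus (x * y) = modulus x * modulus y.
Proof. by apply: of_real_inj; rewrite of_realM !modulusE normrM. Qed.

Lemma modulus0 : modulus (0 : K) = 0.
Proof. by apply: of_real_inj; rewrite modulusE of_real0 normr0. Qed.

Lemma modulus1 : modulus (1 : K) = 1.
Proof.
by apply: of_real_inj; rewrite modulusE normr1; case: k.
Qed.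

Lemma modulus0_eq0 x : modulus x = 0 -> x = 0.
Proof. by move=> x0; apply/normr0_eq0; rewrite -modulusE x0 of_real0. Qed.

End Modulus.

Section SequenceSpaces.
Context {R : realType} {k : scalar_kind}.
Local Notation K := (scalars R k).
Implicit Types (p : \bar R) (a b : nat -> K^o).

(* With respect to the counting measure on nat the library's L^p norm is the
   l_p norm: see Lnorm_counting for p finite, and the essential supremum is the
   supremum since only the empty set is negligible. *)
Definition ell_norm p a : \bar R :=
  ('N[counting]_p [EFin \o (modulus \o a)])%E.

Definition ell_mem p a : Prop := (ell_norm p a < +oo)%E.

Lemma le_Lnorm_counting p (f g : nat -> R) : (1 <= p)%E ->
  (forall n, `|f n| <= `|g n|) ->
  ('N[counting]_p [EFin \o f] <= 'N[counting]_p [EFin \o g])%E.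
Proof.
move=> p1 fg; case: p p1 => [r|_|//].
- rewrite lee_fin => r1; have r0 : 0 < r := lt_le_trans ltr01 r1.
  rewrite !Lnorm_counting//; apply: gt0_ler_poweR.
  + by rewrite invr_ge0 ltW.
  + by rewrite in_itv/= leey andbT nneseries_ge0// => n _ _; rewrite poweR_ge0.
  + by rewrite in_itv/= leey andbT nneseries_ge0// => n _ _; rewrite poweR_ge0.
  + apply: lee_nneseries => n _; first by move=> _; rewrite poweR_ge0.
    by rewrite /= lee_fin ge0_ler_powR ?nnegrE// ltW.
- rewrite unlock /Lnorm; case: ifPn => // _; apply: le_ess_sup.
  by apply: nearW => n /=; rewrite lee_fin.
Qed.

Lemma ell_norm_ge0 p a : (0 <= ell_norm p a)%E.
Proof. exact: Lnorm_ge0. Qed.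

Lemma ell_normD p a b : (1 <= p)%E ->
  (ell_norm p (a + b)%R <= ell_norm p a + ell_norm p b)%E.
Proof.
move=> p1; apply: le_trans (@eminkowski _ _ _ counting
  (modulus \o a) (modulus \o b) p _ _ p1) => //.
apply: le_Lnorm_counting => // n /=.
rewrite !ger0_norm ?addr_ge0 ?modulus_ge0//; exact: ler_modulusD.
Qed.

Lemma ell_memD p a b : (1 <= p)%E ->
  ell_mem p a -> ell_mem p b -> ell_mem p (a + b).
Proof.
move=> p1 pa pb; apply: le_lt_trans (ell_normD _ _ p1) _.
by rewrite lte_add_pinfty.
Qed.

Lemma ell_normZ p (c : K) a : (1 <= p)%E -> ell_mem p a ->
  (ell_norm p (c *: a)%R = (modulus c)%:E * ell_norm p a)%E.
Proof.
move=> p1 pa; have aL : modulus \o a \in Lfun counting p.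
  by rewrite inE; apply/andP; split; rewrite inE.
have := LnormZ (Lfun_Sub p1 aL) (modulus c).
rewrite ger0_norm ?modulus_ge0// => <-; congr Lnorm; apply/funext => n /=.
by rewrite modulusM.
Qed.

Lemma ell_memZ p (c : K) a : (1 <= p)%E -> ell_mem p a -> ell_mem p (c *: a).
Proof.
move=> p1 pa; rewrite /ell_mem ell_normZ// lte_mul_pinfty// lee_fin.
exact: modulus_ge0.
Qed.

Lemma ell_mem0 p : (1 <= p)%E -> ell_mem p 0.
Proof.
move=> p1; rewrite /ell_mem /ell_norm.
rewrite (_ : EFin \o _ = cst 0%E); last first.
  by apply/funext => n /=; rewrite modulus0.
by rewrite Lnorm0// gt_eqF// (lt_le_trans _ p1).
Qed.

Lemma ell_norm0_eq0 p a : (1 <= p)%E -> ell_norm p a = 0%E -> a = 0.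
Proof.
move=> p1 /Lnorm_eq0_eq0 a0.
have [//|N [_ N0 aN]] := a0 _ (lt_le_trans lte01 p1).
have {}N0 : N = set0.
  have {}N0 : @counting nat R N = 0%E by [].
  move: N0; rewrite /counting.
  have [finN /eqP|//] := asboolP.
  by rewrite eqe pnatr_eq0 finmap.cardfs_eq0 => /eqP h; exact: fset_set_set0 h.
apply/funext => n; apply: modulus0_eq0; apply: contrapT => an0.
have : N n by apply: aN => /= h; apply: an0; case: (h I).
by rewrite N0.
Qed.

Record ell_sub p := EllSub {
  ell_carrier : set (nat -> K^o) ;
  ell_carrier_mem : ell_carrier `<=` ell_mem p ;
  ell_carrier_submod : submod_closed [pred a | `[< ell_carrier a >]] }.

End SequenceSpaces.

Definition ell_sub_pred {R : realType} {k : scalar_kind} {p : \bar R}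
    (S : ell_sub (k := k) p) : {pred nat -> (scalars R k)^o} :=
  [pred a | `[< ell_carrier S a >]].

HB.instance Definition _ (R : realType) (k : scalar_kind) (p : \bar R)
    (S : ell_sub (k := k) p) :=
  GRing.isSubmodClosed.Build (scalars R k) (nat -> (scalars R k)^o)
    (ell_sub_pred S) (ell_carrier_submod S).

Definition ell_space {R : realType} {k : scalar_kind} {p : \bar R}
    (p1 : (1 <= p)%E) (S : ell_sub (k := k) p) : Type :=
  {a : nat -> (scalars R k)^o | a \in ell_sub_pred S}.

HB.instance Definition _ (R : realType) (k : scalar_kind) (p : \bar R)
    (p1 : (1 <= p)%E) (S : ell_sub (k := k) p) := SubChoice.on (ell_space p1 S).
HB.instance Definition _ (R : realType) (k : scalar_kind) (p : \bar R)
    (p1 : (1 <= p)%E) (S : ell_sub (k := k) p) :=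
  [SubChoice_isSubLmodule of ell_space p1 S by <:].

Section EllSpace.
Context {R : realType} {k : scalar_kind} {p : \bar R} (p1 : (1 <= p)%E).
Variable S : ell_sub (k := k) p.
Local Notation K := (scalars R k).
Local Notation V := (ell_space p1 S).

Definition ell_space_norm (a : V) : K := of_real (fine (ell_norm p (\val a))).

Let val_mem (a : V) : ell_mem p (\val a).
Proof. by apply: (@ell_carrier_mem _ _ _ S); have /asboolP := valP a. Qed.

Let norm_fin (a : V) : (fine (ell_norm p (\val a)))%:E = ell_norm p (\val a).
Proof. by rewrite fineK// ge0_fin_numE ?ell_norm_ge0//; exact: val_mem. Qed.

Let normD (a b : V) :
  ell_space_norm (a + b) <= ell_space_norm a + ell_space_norm b.
Proof.
rewrite /ell_space_norm -of_realD ler_of_real -lee_fin EFinD !norm_fin.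
exact: ell_normD.
Qed.

Let normZ (c : K) (a : V) : ell_space_norm (c *: a) = `|c| * ell_space_norm a.
Proof.
rewrite /ell_space_norm -modulusE -of_realM; congr of_real.
by apply: EFin_inj; rewrite EFinM !norm_fin; apply: ell_normZ.
Qed.

Let norm0_eq0 (a : V) : ell_space_norm a = 0 -> a = 0.
Proof.
rewrite /ell_space_norm -[in RHS](@of_real0 R k) => /of_real_inj a0.
by apply: val_inj; apply: (@ell_norm0_eq0 _ _ p) => //=; rewrite -norm_fin a0.
Qed.

HB.instance Definition _ :=
  Lmodule_isNormed.Build K V normD normZ norm0_eq0.

End EllSpace.

Section SequenceSpaceInstances.
Context (R : realType) (k : scalar_kind).
Local Notation K := (scalars R k).
Implicit Types a : nat -> K^o.

Let ell_full_submod (p : \bar R) (p1 : (1 <= p)%E) :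
  submod_closed [pred a | `[< @ell_mem R k p a >]].
Proof.
split=> [|c a b]; rewrite !inE.
  exact: ell_mem0.
move=> pa pb; apply: ell_memD => //; exact: ell_memZ.
Qed.

Definition ell_full (p : \bar R) (p1 : (1 <= p)%E) : ell_sub p :=
  EllSub (fun _ => id) (ell_full_submod p1).

Let null_mem : [set a | a @ \oo --> (0 : K^o)] `<=` ell_mem +oo%E.
Proof.
move=> a /= /cvgr0Pnorm_lt /(_ _ ltr01)[N _ aN].
pose M : R := 1 + \sum_(i < N) modulus (a i).
have M0 : 0 <= M by rewrite addr_ge0// sumr_ge0// => i _; exact: modulus_ge0.
have aM n : modulus (a n) <= M.
  have [nN|Nn] := ltnP n N.
    rewrite /M (bigD1 (Ordinal nN))//= addrCA lerDl addr_ge0// sumr_ge0// => i _.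
    exact: modulus_ge0.
  apply: (@le_trans _ _ 1).
    rewrite -(@ler_of_real R k) modulusE (le_trans (ltW (aN n Nn)))//.
    by case: k.
  by rewrite lerDl sumr_ge0// => i _; exact: modulus_ge0.
apply: (@le_lt_trans _ _ M%:E); last exact: ltry.
rewrite /ell_norm unlock /Lnorm; case: ifPn => // _.
apply/ess_supP/nearW => n /=; rewrite lee_fin ger0_norm//; exact: modulus_ge0.
Qed.

Let null_submod : submod_closed [pred a | `[< [set a | a @ \oo --> (0 : K^o)] a >]].
Proof.
split=> [|c a b]; rewrite !inE; first exact: cvg_cst.
move=> /= pa pb.
rewrite -[X in _ --> X](addr0 (0 : K^o)) -[X in _ --> X + _](scaler0 _ c).
by apply: cvgD => //; apply: cvgZl_tmp.
Qed.

Definition null_sub : ell_sub +oo%E := EllSub null_mem null_submod.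

Definition unit_seq (n : nat) : nat -> K^o := fun i => (i == n)%:R.

Definition unit_span : set (nat -> K^o) := [set a |
  exists n (c : nat -> K), a = \sum_(i < n) c i *: unit_seq i].

Let unit_span_mem : unit_span `<=` ell_mem 1%E.
Proof.
move=> _ [n [c ->]]; elim/big_ind : _ => //; first exact: ell_mem0.
  by move=> a b; exact: ell_memD.
move=> i _; apply: ell_memZ => //.
rewrite /ell_mem /ell_norm Lnorm1.
under eq_integral => j _.
  rewrite (_ : `|_|%E = (\1_[set (i : nat)] j)%:E); last first.
    rewrite /= /unit_seq indicE in_set1.
    by case: eqP => _; rewrite ?modulus0 ?modulus1 ?normr0 ?normr1.
  over.
have : (@counting nat R [set (i : nat)] < +oo)%E.
  by rewrite /counting asboolT// ltry.
by rewrite integral_indic// setIT.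
Qed.

Let unit_span_submod : submod_closed [pred a | `[< unit_span a >]].
Proof.
split=> [|c a b]; rewrite !inE.
  by exists 0%N, (fun=> 0); rewrite big_ord0.
move=> [m [d ->]] [n [e ->]].
exists (maxn m n), (fun i => c * (if (i < m)%N then d i else 0) +
  (if (i < n)%N then e i else 0)).
rewrite (big_ord_widen _ (fun i => d i *: unit_seq i) (leq_maxl m n)).
rewrite (big_ord_widen _ (fun i => e i *: unit_seq i) (leq_maxr m n)).
rewrite big_mkcond [X in _ + X]big_mkcond scaler_sumr -big_split/=.
apply: eq_bigr => i _; rewrite scalerDl -scalerA.
by do 2 case: ifP => _; rewrite ?scale0r.
Qed.

Definition unit_span_sub : ell_sub 1%E := EllSub unit_span_mem unit_span_submod.
End SequenceSpaceInstances.

Definition ell (R : realType) (k : scalar_kind) (p : \bar R)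
  (p1 : (1 <= p)%E) : normedModType (scalars R k) := ell_space p1 (ell_full k p1).

Definition c0 (R : realType) (k : scalar_kind) : normedModType (scalars R k) :=
  ell_space (leey 1%E) (null_sub R k).

Definition ell1_0 (R : realType) (k : scalar_kind) :
  normedModType (scalars R k) := ell_space (lexx 1%E) (unit_span_sub R k).

Definition strictly_increasing (f : nat -> nat) : Prop :=
  {homo f : m n / (m < n)%N}.

Definition selectively_sequentially_pseudocompact (X : topologicalType) : Prop :=
  forall U : nat -> set X, (forall n, open (U n) /\ U n !=set0) ->
  exists2 x : nat -> X, forall n, U n (x n) &
    exists2 f : nat -> nat, strictly_increasing f &
      exists l : X, x \o f @ \oo --> l.

Definition selectively_sequentially_pseudocompact_polars {K : numFieldType}
    (Z : tvsType K) : Prop :=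
  forall U : set Z, nbhs 0 U ->
    selectively_sequentially_pseudocompact (set_type (polar U)).

Section Assertions.
Context {R : realType} {k : scalar_kind}.
Local Notation K := (scalars R k).
Implicit Types (p : \bar R) (E L : tvsType K).

Definition weakstar_null {E} (f : nat -> weakstar_dual E) : Prop :=
  f @ \oo --> (0 : weakstar_dual E).

Definition p_summable p (a : nat -> K^o) : Prop :=
  if p == +oo%E then a @ \oo --> (0 : K^o) else ell_mem p a.

Definition weakly_p_summable p {E} (x : nat -> E) : Prop :=
  forall f : dual E, p_summable p (fun n => f (x n)).

Definition weakly_p_convergent p {E} (x : nat -> E) (l : E) : Prop :=
  weakly_p_summable p (fun n => x n - l).

Definition weakly_p_cauchy p {E} (x : nat -> E) : Prop :=
  forall i j : nat -> nat, strictly_increasing i -> strictly_increasing j ->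
    weakly_p_summable p (fun n => x (i n) - x (j n)).

Definition weakly_seq_p_compact p {E} (A : set E) : Prop :=
  forall x : nat -> E, (forall n, A (x n)) ->
  exists2 i : nat -> nat, strictly_increasing i &
    exists2 l : E, A l & weakly_p_convergent p (x \o i) l.

Definition relatively_weakly_seq_p_compact p {E} (A : set E) : Prop :=
  forall x : nat -> E, (forall n, A (x n)) ->
  exists2 i : nat -> nat, strictly_increasing i &
    exists l : E, weakly_p_convergent p (x \o i) l.

Definition weakly_seq_p_precompact p {E} (A : set E) : Prop :=
  forall x : nat -> E, (forall n, A (x n)) ->
  exists2 i : nat -> nat, strictly_increasing i & weakly_p_cauchy p (x \o i).

Definition limited {E} (A : set E) : Prop :=
  A !=set0 /\ forall f : nat -> weakstar_dual E, weakstar_null f ->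
    ereal_sup [set (modulus (f n a))%:E | a in A] @[n --> \oo] --> 0%E.

Definition weakstar_p_convergent p {E L} (T : E -> L) : Prop :=
  forall (f : nat -> weakstar_dual L) (x : nat -> E),
    weakstar_null f -> weakly_p_summable p x ->
    f n (T (x n)) @[n --> \oo] --> (0 : K^o).

Definition p_convergent p {E L} (T : E -> L) : Prop :=
  forall x : nat -> E, weakly_p_summable p x -> T \o x @ \oo --> (0 : L).

Definition weakly_seq_p_compact_map p {E L} (T : E -> L) : Prop :=
  exists2 U : set E, nbhs 0 U & relatively_weakly_seq_p_compact p (T @` U).

Definition weakly_seq_p_precompact_map p {E L} (T : E -> L) : Prop :=
  exists2 U : set E, nbhs 0 U & weakly_seq_p_precompact p (T @` U).

Definition limited_map {E L} (T : E -> L) : Prop :=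
  exists2 U : set E, nbhs 0 U & limited (T @` U).

Definition absolutely_convex {E} (A : set E) : Prop :=
  forall (x y : E) (a b : K), A x -> A y -> `|a| + `|b| <= 1 ->
    A (a *: x + b *: y).

Definition closed_abs_convex_hull {E} (A : set E) : set E :=
  smallest [set C | closed C /\ absolutely_convex C] A.

Definition weakly_seq_locally_p_complete p E : Prop :=
  forall x : nat -> E, weakly_p_summable p x ->
    weakly_seq_p_precompact p (closed_abs_convex_hull (range x)).

Definition c0_barrelled E : Prop :=
  forall f : nat -> weakstar_dual E, weakstar_null f ->
    equicontinuous [set: nat] (fun n => f n : E -> K^o).

(* The Cauchy condition is that of the topological vector space; the uniformity
   carried by a tvsType is not required to be translation invariant. *)
Definition sequentially_complete E : Prop :=
  forall x : nat -> E,
    (forall U : set E, nbhs 0 U ->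
      exists N : nat, forall m n, (N <= m)%N -> (N <= n)%N -> U (x m - x n)) ->
    exists l : E, x @ \oo --> l.

End Assertions.

(* Main.v *)
Require Import Defs.
From HB Require Import structures.
From mathcomp Require Import all_boot all_order all_algebra.
From mathcomp Require Import all_classical all_reals all_analysis.
From mathcomp Require Import complex ess_sup_inf ring lra.
Set Implicit Arguments.
Unset Strict Implicit.
Unset Printing Implicit Defensive.
Import Order.TTheory GRing.Theory Num.Theory.
Import numFieldNormedType.Exports.
Local Open Scope classical_set_scope.
Local Open Scope ring_scope.

(**
Every assertion compares a weak-star null sequence (f_n) of functionals on L
with a weakly p-summable sequence (x_n) of E, and asks whether f_n (T x_n)
tends to 0; the work is to pass between such double sequences, sets and
operators.

Assertions on sets.  If T fails to map a precompact set to a limited one, there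
are points a_n with |f_n (T a_n)| > e and (a_n) weakly p-Cauchy.  Since f is
weak-star null, sparse indices j_n make f_(j_n) (T a_n) small, and the weakly
p-summable sequence a_(j_n) - a_n contradicts (i)
(weakstar_p_convergent_precompact).  In the other direction, the range of a
weakly p-summable sequence, with 0 added, is weakly sequentially p-compact
(p_summable_range_compact).

Assertions on operators out of L.  If a weakly null sequence z does not tend to
0 in a space Z whose polars are selectively sequentially pseudocompact,
Hahn-Banach and pseudocompactness produce an equicontinuous weak-star null sequence of
functionals that stays away from 0 on a subsequence of z
(pseudocompact_polars_separate).  This proves (v) from (i).  Equicontinuous
weak-star null sequences are the coordinates of operators into c_0
(c0_operator), so (v) follows from (vi), which closes the circle (v), (v'),
(vi) without completing any quotient of Z, once c_0 is known to be a Banach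
space with pseudocompact polars (c0_complete, c0_polars).  When L is
c_0-barrelled every weak-star null sequence is equicontinuous, and (i) follows
from (vi).

Assertions on operators into E.  The passage to adjoints is the definition of
the strong topology (limited_map_adjoint, adjoint_limited_map).  A weakly
p-summable sequence x is the image of the unit vectors under
a |-> sum_n a_n x_n, defined on l_1^0, or on l_q with q the exponent conjugate
to p when E is sequentially complete.  Continuity of this map is an instance of
the theorem of Mackey that weakly bounded sets are bounded
(weakly_bounded_csnorm), and if T composed with it is limited then (i) holds for
x (ell1_0_limited_weakstar, ell_limited_weakstar).  Conversely, for 1 < p < oo
every operator from l_q to E is weakly sequentially p-compact
(ell_operator_compact): a bounded sequence has a subsequence converging
coordinatewise, and a gliding hump makes the differences from the limit almost
disjointly supported, so that their linear combinations are controlled by the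
l_q norm of the coefficients; the converse of Hoelder's inequality then gives
p-summability.

Real and complex scalars are treated together through the real-valued modulus,
and all limits of bounded families are taken along ultrafilters.
*)

(** * Scalars and ultrafilter limits *)

Section Scalars.
Context {R : realType} {k : scalar_kind}.
Local Notation K := (scalars R k).
Implicit Types (x y : K) (r s : R).

Lemma of_real1 : of_real 1 = 1 :> K. Proof. by case: k. Qed.

Lemma of_realN r : of_real (- r) = - of_real r :> K.
Proof. by apply/eqP; rewrite -subr_eq0 opprK -of_realD addNr of_real0. Qed.

Lemma ltr_of_real r s : (of_real r < of_real s :> K) = (r < s).
Proof.
by rewrite !lt_neqAle ler_of_real (inj_eq (@of_real_inj R k)).
Qed.

Lemma modulus_of_real r : modulus (of_real r : K) = `|r|.
Proof.
apply: (@of_real_inj R k); rewrite modulusE; case: k => [//|].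
by rewrite /of_real normc_def/= expr0n/= addr0 sqrtr_sqr.
Qed.

(** Positivity in a complex field forces a scalar to be real, so the radii of
balls can always be taken in R. *)
Lemma gt0_of_real (e : K) : 0 < e -> e = of_real (modulus e) /\ 0 < modulus e.
Proof.
move=> e0; have eE : e = of_real (modulus e).
  by rewrite modulusE gtr0_norm.
by split=> //; rewrite -ltr_of_real -eE of_real0.
Qed.

Lemma modulusN x : modulus (- x) = modulus x.
Proof. by apply: (@of_real_inj R k); rewrite !modulusE normrN. Qed.

Lemma modulus_distC x y : modulus (x - y) = modulus (y - x).
Proof. by rewrite -modulusN opprB. Qed.

Lemma modulus_sum I (s : seq I) (P : pred I) (F : I -> K) :
  modulus (\sum_(i <- s | P i) F i) <= \sum_(i <- s | P i) modulus (F i).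
Proof.
elim/big_ind2 : _ => //; first by rewrite modulus0.
move=> a b c d ab cd; apply: le_trans (ler_modulusD _ _) _; exact: lerD.
Qed.

Lemma cvg_modulusP {T} (F : set_system T) {FF : Filter F} (u : T -> K^o) (l : K^o) :
  u @ F --> l <-> forall e : R, 0 < e -> \forall t \near F, modulus (l - u t) < e.
Proof.
split=> [/cvgrPdist_lt H e e0|H]; last apply/cvgrPdist_lt => e e0.
  have /H : 0 < of_real e :> K by rewrite -of_real0 ltr_of_real.
  by apply: filterS => t; rewrite -modulusE ltr_of_real.
have [eE me0] := gt0_of_real e0.
by have := H _ me0; apply: filterS => t; rewrite {2}eE -modulusE ltr_of_real.
Qed.

(** The phase of x, used to rotate values onto the positive half-line. *)
Lemma unit_modulus_polar x : exists2 c : K, modulus c = 1 &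
  c * x = of_real (modulus x).
Proof.
have [->|x0] := eqVneq x 0.
  by exists 1; rewrite ?modulus1// mulr0 modulus0 of_real0.
exists (of_real (modulus x) / x); last by rewrite divfK.
apply: (@of_real_inj R k); rewrite modulusE of_real1 normrM normfV -!modulusE.
rewrite modulus_of_real ger0_norm ?modulus_ge0// divff//.
by apply: contra x0 => /eqP; rewrite modulusE => /normr0_eq0/eqP.
Qed.

Lemma modulus_Re_Im (a : R[i]) :
  `|complex.Re a| <= modulus (a : scalars R complex_scalars) /\
  `|complex.Im a| <= modulus (a : scalars R complex_scalars).
Proof.
rewrite /modulus normc_def; case: a => a b /=; split;
  by rewrite -sqrtr_sqr ler_sqrt ?lerDl ?lerDr ?sqr_ge0// addr_ge0// sqr_ge0.
Qed.

End Scalars.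

Lemma ultra_cvg_real (R : realType) T (G : set_system T) (u : T -> R) (M : R) :
  UltraFilter G -> G [set t | `|u t| <= M] -> exists l : R, u @ G --> l.
Proof.
move=> UG GM; have FG : ProperFilter G by exact: ultra_proper.
have GM' : G (u @^-1` [set` `[- M, M]]).
  by apply: filterS GM => t /=; rewrite in_itv/= ler_norml.
have := @segment_compact R (- M) M; move=> /(_ (u @ G) _ GM').
case=> l [_ lc]; exists l; apply/cvgrPdist_lt => e e0.
have [//|nG] := in_ultra_setVsetC [set t | `|l - u t| < e] UG.
have [y []]: (~` [set y | `|l - y| < e]) `&` (ball (l : R) e) !=set0.
  by apply: lc; [exact: nG|exact: nbhsx_ballx].
by rewrite -ball_normE.
Qed.

(** Along a fixed ultrafilter all bounded families converge simultaneously.  This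
stands in both for the completeness of the scalars and for the extraction of
diagonal subsequences. *)
Lemma ultra_cvg (R : realType) (k : scalar_kind) T (G : set_system T)
    (u : T -> (scalars R k)^o) (M : R) :
  UltraFilter G -> G [set t | modulus (u t) <= M] ->
  exists l : (scalars R k)^o, u @ G --> l.
Proof.
move=> UG GM; have FG : ProperFilter G by exact: ultra_proper.
case: k u GM => u GM.
  by have [l ul] := ultra_cvg_real UG GM; exists l.
have [a ua] : exists l : R, complex.Re (u t) @[t --> G] --> l.
  apply: (@ultra_cvg_real _ _ _ _ M) => //; apply: filterS GM => t /=.
  exact/le_trans/(modulus_Re_Im (u t)).1.
have [b ub] : exists l : R, complex.Im (u t) @[t --> G] --> l.
  apply: (@ultra_cvg_real _ _ _ _ M) => //; apply: filterS GM => t /=.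
  exact/le_trans/(modulus_Re_Im (u t)).2.
exists (Complex a b); apply/(@cvg_modulusP R complex_scalars) => e e0.
have e2 : 0 < e / 2 by rewrite divr_gt0.
have /cvgrPdist_lt/(_ _ e2) ua' := ua; have /cvgrPdist_lt/(_ _ e2) ub' := ub.
near=> t; have -> : (Complex a b : R[i]) - u t =
    (a - complex.Re (u t))%:C%C + 'i%C * (b - complex.Im (u t))%:C%C.
  by case: (u t) => x y /=; simpc.
apply: (le_lt_trans (@ler_modulusD R complex_scalars _ _)).
rewrite (@modulusM R complex_scalars) [ltRHS]splitr.
rewrite (_ : @modulus R complex_scalars ('i%C : R[i]) = 1) ?mul1r; last first.
  by rewrite /modulus normc_def/= expr0n/= add0r expr1n sqrtr1.
rewrite !(@modulus_of_real R complex_scalars); apply: ltrD; near: t.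
- exact: ua'.
- exact: ub'.
Unshelve. all: by end_near. Qed.

(** * Continuous seminorms *)

HB.instance Definition _ (K : numFieldType) (E : tvsType K) (f : dual E) :=
  GRing.isLinear.Build K E K^o _ (dual_fun f) (operator_linear f).
HB.instance Definition _ (K : numFieldType) (E : tvsType K)
    (S : polar_family E) (f : polar_dual S) :=
  GRing.isLinear.Build K E K^o _ (polar_dual_fun f) (operator_linear f).

Section Seminorms.
Context {R : realType} {k : scalar_kind}.
Local Notation K := (scalars R k).
Implicit Types (E L : tvsType K).

(** Continuous seminorms, with values in R for both kinds of scalars.  The
neighbourhood condition at 0 amounts to continuity (csnorm_nbhsx), and these
seminorms generate the topology (nbhs_csnorm). *)
Record csnorm E (q : E -> R) : Prop := Csnorm {
  csnormD : forall x y, q (x + y) <= q x + q y ;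
  csnormZ : forall (c : K) x, q (c *: x) = modulus c * q x ;
  csnorm_nbhs : nbhs 0 [set x | q x < 1] }.

Section Theory.
Context {E : tvsType K} {q : E -> R} (cq : csnorm q).

Lemma csnorm0 : q 0 = 0.
Proof. by rewrite -(scale0r (0 : E)) (csnormZ cq) modulus0 mul0r. Qed.

Lemma csnormN x : q (- x) = q x.
Proof. by rewrite -scaleN1r (csnormZ cq) modulusN modulus1 mul1r. Qed.

Lemma csnorm_ge0 x : 0 <= q x.
Proof.
have := csnormD cq x (- x).
by rewrite subrr csnorm0 csnormN -mulr2n pmulrn_lge0.
Qed.

Lemma csnorm_distC x y : q (x - y) = q (y - x).
Proof. by rewrite -csnormN opprB. Qed.

Lemma csnorm_sum I (r : seq I) (P : pred I) (F : I -> E) :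
  q (\sum_(i <- r | P i) F i) <= \sum_(i <- r | P i) q (F i).
Proof.
elim/big_ind2 : _ => //; first by rewrite csnorm0.
by move=> a b c d ab cd; apply: le_trans (csnormD cq _ _) _; exact: lerD.
Qed.

Lemma csnorm_nbhsx x e : 0 < e -> nbhs x [set y | q (y - x) < e].
Proof.
move=> e0; have ne : of_real e != 0 :> K.
  by rewrite -(@of_real0 R k) (inj_eq (@of_real_inj R k)) gt_eqF.
have := nbhsT x (nbhs0Z ne (csnorm_nbhs cq)).
apply: filterS => _ [_ [z /= qz <-] <-].
rewrite addrAC subrr add0r (csnormZ cq) modulus_of_real gtr0_norm//.
by rewrite gtr_pMr.
Qed.

End Theory.

Lemma csnorm_mul E (q : E -> R) (M : R) : 0 <= M -> csnorm q ->
  csnorm (fun x => M * q x).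
Proof.
move=> M0 cq; split => [x y|c x|].
- by rewrite -mulrDr ler_wpM2l// (csnormD cq).
- by rewrite (csnormZ cq) mulrCA.
- have M1 : 0 < (M + 1)^-1 by rewrite invr_gt0 ltr_wpDl.
  have := csnorm_nbhsx cq 0 M1; apply: filterS => x /=; rewrite subr0 => qx.
  have [->|Mn0] := eqVneq M 0; first by rewrite mul0r.
  have {Mn0}M0' : 0 < M by rewrite lt_neqAle eq_sym Mn0.
  apply: (@lt_trans _ _ (M * (M + 1)^-1)); first by rewrite ltr_pM2l.
  by rewrite ltr_pdivrMr ?mul1r ?ltrDl// ltr_wpDl.
Qed.

Lemma csnorm_modulus E (f : dual E) : csnorm (fun x => modulus (f x)).
Proof.
split=> [x y|c x|].
- by rewrite linearD; exact: ler_modulusD.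
- by rewrite linearZ; exact: modulusM.
- have := @operator_continuous _ _ _ f 0.
  move=> /cvg_modulusP/(_ _ ltr01); apply: filterS => x.
  by rewrite linear0 sub0r modulusN.
Qed.

Lemma nbhs_translate E (x : E) (U : set E) :
  nbhs x U -> nbhs 0 [set y | U (x + y)].
Proof.
move=> /(nbhsB (- x)); rewrite addNr; apply: filterS => _ [y Uy <-] /=.
by rewrite addNKr.
Qed.

Lemma linear_continuous_csnorm E L (T : E -> L) : linear T ->
  (forall U, nbhs (0 : L) U ->
    exists2 q : E -> R, csnorm q & forall x, q x < 1 -> U (T x)) ->
  continuous T.
Proof.
move=> lT H x U /nbhs_translate U0.
have [q cq qU] := H _ U0.
have := csnorm_nbhsx cq x ltr01.
apply: filterS => y /qU /=.
by rewrite (additive_linear lT) addrC subrK.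
Qed.

Lemma ball0_modulus (e d : K) : 0 < e -> modulus d < modulus e ->
  ball (0 : K^o) e d.
Proof.
move=> /gt0_of_real[eE _] de.
by rewrite -ball_normE/= sub0r normrN -modulusE eE ltr_of_real.
Qed.

(** How functionals constructed by hand enter the dual. *)
Lemma csnorm_dual E (q : E -> R) (f : E -> K^o) : csnorm q -> linear f ->
  (forall x, modulus (f x) <= q x) -> exists g : dual E, g =1 f.
Proof.
move=> cq lf fq.
have cf : continuous f.
  apply: linear_continuous_csnorm => // U.
  move=> /nbhs_ballP[e /= e0 eU]; have [eE me0] := gt0_of_real e0.
  exists (fun x => (modulus e)^-1 * q x).
    by apply: csnorm_mul => //; rewrite invr_ge0 ltW.
  move=> x; rewrite mulrC ltr_pdivrMr// mul1r => qx; apply: eU.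
  apply: ball0_modulus => //; exact: le_lt_trans (fq x) qx.
by exists (Sub f (operator_mem lf cf)) => x.
Qed.

(** Given a convex neighbourhood C of 0, take the points all of whose multiples by
scalars of modulus at most 1 lie in C.  They still form a neighbourhood of 0
because scaling is continuous at (0, 0). *)
Lemma balanced_nbhs E (U : set E) : nbhs 0 U ->
  exists V : set E, [/\ nbhs 0 V, V `<=` U,
    (forall (c : K) x, modulus c <= 1 -> V x -> V (c *: x)) &
    (forall x y (t : R), 0 <= t <= 1 -> V x -> V y ->
       V (of_real t *: x + of_real (1 - t) *: y))].
Proof.
move=> U0; have [B Bc [Bo Bn]] := @locally_convex _ E.
have [C [BC C0] CU] := Bn _ _ U0.
have nC : nbhs 0 C by apply: open_nbhs_nbhs; split => //; exact: Bo.
have := @scale_continuous K E (0, 0) C.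
rewrite /= scale0r => /(_ nC)[[/= D W] [nD nW] DW].
move: nD => /nbhs_ballP[e /= e0 eD]; have [eE me0] := gt0_of_real e0.
pose V := [set x : E | forall c : K, modulus c <= 1 -> C (c *: x)].
exists V; split.
- pose d : K := of_real (modulus e / 2).
  have dn0 : d != 0.
    by rewrite -(@of_real0 R k) (inj_eq (@of_real_inj R k)) gt_eqF// divr_gt0.
  have := nbhs0Z dn0 nW; apply: filterS => _ [w Ww <-] c c1.
  rewrite scalerA; apply: (DW (c * d, w)); split=> //=.
  apply: eD; apply: ball0_modulus => //.
  rewrite modulusM modulus_of_real gtr0_norm ?divr_gt0//.
  apply: (@le_lt_trans _ _ (1 * (modulus e / 2))).
    by rewrite ler_wpM2r// divr_ge0// ltW.
  by rewrite mul1r ltr_pdivrMr// ltr_pMr// ltr1n.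
- move=> x /(_ 1); rewrite modulus1 lexx scale1r => /(_ isT); exact: CU.
- move=> c x c1 Vx d d1; rewrite scalerA; apply: Vx.
  by rewrite modulusM mulr_ile1// modulus_ge0.
- move=> x y t /andP[t0 t1] Vx Vy c c1.
  have t0' : 0 <= of_real t :> K by rewrite -of_real0 ler_of_real.
  have t1' : of_real t <= 1 :> K by rewrite -of_real1 ler_of_real.
  have := Bc _ (mem_set BC) (c *: x) (c *: y).
  have := Bc _ (mem_set BC) (c *: x) (c *: y) (Itv01 t0' t1').
  rewrite !inE => /(_ (Vx c c1) (Vy c c1)).
  rewrite [X in C X -> _](_ : _ =
    of_real t *: (c *: x) + (1 - of_real t) *: (c *: y))//.
  rewrite scalerDr !scalerA mulrC [c * of_real (1 - t)]mulrC.
  rewrite [of_real (1 - t)](_ : _ = 1 - of_real t)//.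
  by apply/eqP; rewrite eq_sym subr_eq -of_realD subrK of_real1.
Qed.

(** The seminorm is the Minkowski gauge of a convex balanced neighbourhood. *)
Lemma nbhs_csnorm E (U : set E) : nbhs 0 U ->
  exists2 q : E -> R, csnorm q & forall x, q x < 1 -> U x.
Proof.
move=> /balanced_nbhs[V [nV VU Vb Vc]].
pose G x : set R := [set r | 0 < r /\ V (of_real r^-1 *: x)].
pose q x := inf (G x).
have G_inf x : has_inf (G x).
  split; last by exists 0 => r [r0 _]; exact: ltW.
  have := @scale_continuous K E (0, x) V.
  rewrite /= scale0r => /(_ nV)[[/= D W] [nD nW] DW].
  move: nD => /nbhs_ballP[e /= e0 eD]; have [eE me0] := gt0_of_real e0.
  exists (modulus e / 2)^-1; split; first by rewrite invr_gt0 divr_gt0.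
  apply: (DW (_, x)); split=> /=; last exact: nbhs_singleton.
  apply: eD; apply: ball0_modulus => //.
  rewrite invrK modulus_of_real gtr0_norm ?divr_gt0//.
  by rewrite ltr_pdivrMr// ltr_pMr// ltr1n.
have q_ge0 x : 0 <= q x.
  by apply: lb_le_inf => [|r [r0 _]]; [exact: (G_inf x).1|exact: ltW].
have q_lt x r : q x < r -> V (of_real r^-1 *: x) /\ 0 < r.
  move=> qr; have r0 : 0 < r := le_lt_trans (q_ge0 x) qr; split=> //.
  have [s [s0 Vs] sr] := inf_lt (G_inf x).1 qr.
  have -> : of_real r^-1 *: x = of_real (s / r) *: (of_real s^-1 *: x).
    by rewrite scalerA -of_realM mulrAC divff ?gt_eqF// mul1r.
  apply: Vb => //; rewrite modulus_of_real ger0_norm; last first.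
    by rewrite divr_ge0// ltW.
  by rewrite ler_pdivrMr// mul1r ltW.
have q_le x r : 0 < r -> V (of_real r^-1 *: x) -> q x <= r.
  by move=> r0 Vr; apply: ge_inf; [exact: (G_inf x).2|split].
have qZ_le (c : K) x : q (c *: x) <= modulus c * q x.
  apply/ler_addgt0Pr => e e0.
  have [->|c0] := eqVneq c 0.
    rewrite scale0r modulus0 mul0r add0r; apply: q_le => //.
    by rewrite scaler0; exact: nbhs_singleton.
  have mc : 0 < modulus c.
    rewrite lt_neqAle modulus_ge0 andbT eq_sym; apply: contra c0 => /eqP.
    by move=> /modulus0_eq0 ->.
  have qx : q x < q x + e / modulus c by rewrite ltrDl divr_gt0.
  have [Vx r0] := q_lt _ _ qx.
  apply: q_le; first by rewrite ltr_wpDl// mulr_ge0// ltW.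
  have -> : modulus c * q x + e = modulus c * (q x + e / modulus c).
    by rewrite mulrDr [e / _]mulrC mulVKf ?gt_eqF.
  rewrite invfM of_realM scalerA mulrAC -scalerA; apply: Vb => //.
  by rewrite modulusM modulus_of_real gtr0_norm ?invr_gt0// mulVf ?gt_eqF.
exists q; last by move=> x /q_lt[]; rewrite invr1 of_real1 scale1r => /VU.
split=> [x y|c x|].
- apply/ler_addgt0Pr => e e0.
  have e2 : 0 < e / 2 by rewrite divr_gt0.
  have /q_lt[Vx r0] : q x < q x + e / 2 by rewrite ltrDl.
  have /q_lt[Vy s0] : q y < q y + e / 2 by rewrite ltrDl.
  move: Vx Vy r0 s0; set r := q x + _; set s := q y + _ => Vx Vy r0 s0.
  have -> : q x + q y + e = r + s by rewrite /r /s addrACA -splitr.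
  have rs0 : 0 < r + s by exact: addr_gt0.
  apply: q_le => //.
  have t01 : 0 <= r / (r + s) <= 1.
    by rewrite ler_pdivrMr// mul1r lerDl divr_ge0 ltW.
  have := Vc _ _ _ t01 Vx Vy.
  rewrite !scalerA -!of_realM scalerDr.
  rewrite [r / (r + s) / r](_ : _ = (r + s)^-1); last first.
    by rewrite mulrAC divff ?gt_eqF// mul1r.
  rewrite [_ / s](_ : _ = (r + s)^-1)//.
  have -> : 1 - r / (r + s) = s / (r + s).
    by rewrite -[1](@divff _ (r + s)) ?gt_eqF// -mulrBl addrC addKr.
  by rewrite mulrAC divff ?gt_eqF// mul1r.
- apply/eqP; rewrite eq_le qZ_le/=.
  have [->|c0] := eqVneq c 0; first by rewrite modulus0 mul0r.
  have mc : 0 < modulus c.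
    rewrite lt_neqAle modulus_ge0 andbT eq_sym; apply: contra c0 => /eqP.
    by move=> /modulus0_eq0 ->.
  rewrite -ler_pdivlMl// -{1}(scalerK c0 x); apply: le_trans (qZ_le _ _) _.
  rewrite ler_wpM2r//; have : modulus (c^-1 * c) = 1 by rewrite mulVf ?modulus1.
  by rewrite modulusM => /(canRL (mulfK _)) ->; rewrite ?gt_eqF// mul1r.
- have n2 : of_real 2^-1 != 0 :> K.
    by rewrite -(@of_real0 R k) (inj_eq (@of_real_inj R k)) gt_eqF.
  have := nbhs0Z n2 nV; apply: filterS => _ [v Vv <-] /=.
  apply: (@le_lt_trans _ _ (2^-1)); last by rewrite invf_lt1// ltr1n.
  apply: q_le; rewrite ?invr_gt0// invrK scalerA -of_realM divff ?of_real1//.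
  by rewrite scale1r.
Qed.

End Seminorms.

Section SeminormBounds.
Context {R : realType} {k : scalar_kind}.
Local Notation K := (scalars R k).

(** A bound on the open unit ball of q spreads by homogeneity.  Rescaling by
q x + e rather than by q x covers the points where q vanishes. *)
Lemma csnorm_bound (E : tvsType K) (q : E -> R) (f : E -> K^o) : csnorm q ->
  linear f -> (forall x, q x < 1 -> modulus (f x) <= 1) ->
  forall x, modulus (f x) <= q x.
Proof.
move=> cq lf fq x; apply/ler_addgt0Pr => e e0.
have r0 : 0 < q x + e by rewrite ltr_wpDl ?(csnorm_ge0 cq).
have := fq (of_real (q x + e)^-1 *: x).
have -> : f (of_real (q x + e)^-1 *: x) = of_real (q x + e)^-1 * f x.
  exact: (scalable_linear lf).
rewrite (csnormZ cq) modulusM modulus_of_real gtr0_norm ?invr_gt0//.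
by rewrite ![_^-1 * _]mulrC ltr_pdivrMr// ler_pdivrMr// mul1r; apply; rewrite ltrDl.
Qed.

Lemma nbhs0_normP (X : normedModType K) (U : set X) : nbhs 0 U ->
  exists2 r : R, 0 < r & forall x, modulus (`|x| : K) < r -> U x.
Proof.
move=> /nbhs_ballP[e /= e0 eU]; have [eE me0] := gt0_of_real e0.
exists (modulus e) => // x xe; apply: eU.
rewrite -ball_normE/= sub0r normrN eE -[`|x|](ger0_norm)// -modulusE.
by rewrite ltr_of_real.
Qed.

Lemma csnorm_norm (X : normedModType K) : csnorm (fun x : X => modulus (`|x| : K)).
Proof.
split=> [x y|c x|].
- rewrite -(@ler_of_real R k) of_realD !modulusE !normr_id.
  exact: ler_normD.
- apply: (@of_real_inj R k); rewrite of_realM !modulusE !normr_id.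
  exact: normrZ.
- apply/nbhs_ballP; exists 1 => //= x; rewrite -ball_normE/= sub0r normrN => x1.
  by rewrite -(@ltr_of_real R k) modulusE normr_id of_real1.
Qed.

Lemma cvg0_normP T (F : set_system T) (X : normedModType K) (u : T -> X) :
  Filter F ->
  u @ F --> (0 : X) <-> forall e : R, 0 < e ->
    \forall t \near F, modulus (`|u t| : K) < e.
Proof.
move=> FF; split=> [uF e e0|H U /nbhs0_normP[r r0 rU]].
  have := csnorm_nbhsx (csnorm_norm X) 0 e0 => /uF.
  by apply: (@filterS _ F) => t /=; rewrite subr0.
by apply: (@filterS _ F) (H r r0) => t; exact: rU.
Qed.

Lemma cvg0_csnormP T (F : set_system T) (E : tvsType K) (u : T -> E) :
  Filter F ->
  u @ F --> (0 : E) <-> forall q : E -> R, csnorm q ->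
    \forall t \near F, q (u t) < 1.
Proof.
move=> FF; split=> [uF q cq|H U /nbhs_csnorm[q cq qU]].
  by have := csnorm_nbhs cq => /uF; apply: (@filterS _ F).
by apply: (@filterS _ F) (H q cq) => t; exact: qU.
Qed.

Lemma csnorm_nbhs0 (E : tvsType K) (q : E -> R) e : 0 < e -> csnorm q ->
  nbhs 0 [set x | q x < e].
Proof.
move=> e0 cq; have := csnorm_nbhsx cq 0 e0.
by apply: filterS => x /=; rewrite subr0.
Qed.

Lemma cvg_csnormP T (F : set_system T) (E : tvsType K) (u : T -> E) (l : E) :
  Filter F ->
  u @ F --> l <-> forall (q : E -> R) (e : R), csnorm q -> 0 < e ->
    \forall t \near F, q (l - u t) < e.
Proof.
move=> FF; split=> [ul q e cq e0|H U /nbhs_translate/nbhs_csnorm[q cq qU]].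
  have := csnorm_nbhsx cq l e0 => /ul; apply: (@filterS _ F) => t /=.
  by rewrite (csnorm_distC cq).
apply: (@filterS _ F) (H q 1 cq ltr01) => t; rewrite (csnorm_distC cq) => /qU /=.
by rewrite addrC subrK.
Qed.

End SeminormBounds.

(** * The Hahn-Banach theorem *)

Section HahnBanach.
Context {R : realType} {k : scalar_kind}.
Local Notation K := (scalars R k).

(** Zorn's lemma is applied to graphs.  A linear relation dominated by q is
automatically single-valued: if (0, a) belongs to it, then a <= q 0 and
- a <= q 0.  The line G0 spanned by (x0, q x0) is adjoined to every member of
the ordered family, since the union of the empty chain must be admissible
too. *)
Lemma hahn_banach_real (E : lmodType K) (q : E -> R) (x0 : E) :
    (forall x y, q (x + y) <= q x + q y) ->
    (forall (c : K) x, q (c *: x) = modulus c * q x) ->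
  exists f : E -> R, [/\ forall x y, f (x + y) = f x + f y,
    forall r x, f (of_real r *: x) = r * f x,
    forall x, f x <= q x & f x0 = q x0].
Proof.
move=> qD qZ.
have q0 : q 0 = 0 by rewrite -(scale0r (0 : E)) qZ modulus0 mul0r.
have qN x : q (- x) = q x by rewrite -scaleN1r qZ modulusN modulus1 mul1r.
have q_ge0 x : 0 <= q x.
  by have := qD x (- x); rewrite subrr q0 qN -mulr2n pmulrn_lge0.
have oN r : of_real (- r) = - of_real r :> K by exact: of_realN.
pose Q (H : set (E * R)) :=
  (forall u v r, H u -> H v -> H (u.1 + of_real r *: v.1, u.2 + r * v.2)) /\
  (forall u, H u -> u.2 <= q u.1).
pose G0 : set (E * R) := [set (of_real r *: x0, r * q x0) | r in [set: R]].
have QG0 : Q G0.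
  split=> [_ _ r [s _ <-] [t _ <-]|_ [s _ <-]] /=.
    exists (s + r * t) => //.
    by rewrite of_realD of_realM scalerDl scalerA mulrDl mulrA.
  by rewrite qZ modulus_of_real ler_wpM2r// ler_norm.
have [F FP Ftot|G [PG Gmax]] := @Zorn_bigcup _ [set G | Q (G `|` G0)].
  have H u v : (\bigcup_(X in F) X `|` G0) u -> (\bigcup_(X in F) X `|` G0) v ->
      exists H, [/\ Q H, H u, H v & H `<=` \bigcup_(X in F) X `|` G0].
    have sub X : F X -> X `|` G0 `<=` \bigcup_(X in F) X `|` G0.
      by move=> FX; apply: setSU; exact: bigcup_sup.
    move=> [[X FX Xu]|Gu] [[Y FY Yv]|Gv].
    - have [XY|YX] := Ftot _ _ FX FY.
        by exists (Y `|` G0); split; [exact: FP|left; exact: XY|left|exact: sub].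
      by exists (X `|` G0); split; [exact: FP|left|left; exact: YX|exact: sub].
    - by exists (X `|` G0); split; [exact: FP|left|right|exact: sub].
    - by exists (Y `|` G0); split; [exact: FP|right|left|exact: sub].
    - by exists G0; split=> //; exact: subsetUr.
  split=> [u v r Uu Uv|u Uu].
    by have [X [[QX _] Xu Xv]] := H _ _ Uu Uv; apply; exact: QX.
  by have [X [[_ QX] Xu _ _]] := H _ _ Uu Uu; exact: QX.
set H := G `|` G0 in PG; have [Hlin Hq] := PG.
have H0 : H (0, 0) by right; exists 0; rewrite // of_real0 scale0r mul0r.
have HD x a y b : H (x, a) -> H (y, b) -> H (x + y, a + b).
  by move=> Hx Hy; have := Hlin _ _ 1 Hx Hy; rewrite /= of_real1 scale1r mul1r.
have HZ x a r : H (x, a) -> H (of_real r *: x, r * a).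
  by move=> Hx; have := Hlin _ _ r H0 Hx; rewrite /= !add0r.
have HN x a : H (x, a) -> H (- x, - a).
  by move=> /(HZ _ _ (- 1)); rewrite oN of_real1 scaleN1r mulN1r.
have Hfun x a b : H (x, a) -> H (x, b) -> a = b.
  move=> Hx /HN Hx'; have := Hq _ (HD _ _ _ _ Hx Hx').
  have := Hq _ (HN _ _ (HD _ _ _ _ Hx Hx')).
  rewrite /= subrr oppr0 q0; lra.
have Htot z : exists a, H (z, a).
  apply: contrapT => /forallNP Hz.
  pose S : set R := [set u.2 - q (u.1 - z) | u in H].
  have Sub x a : H (x, a) -> ubound S (q (x + z) - a).
    move=> Hx _ [[y b] Hy <-] /=; rewrite lerBrDr addrAC lerBlDr.
    have := Hq _ (HD _ _ _ _ Hx Hy) => /=; rewrite addrC => /le_trans; apply.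
    by rewrite -[X in q X](_ : (x + z) + (y - z) = _) ?qD// addrACA subrr addr0.
  have S0 : S !=set0 by exists (0 - q (0 - z)), (0, 0).
  have supS : has_sup S by split=> //; exists (q (0 + z) - 0); exact: Sub.
  pose c := sup S.
  have c1 x a : H (x, a) -> a - c <= q (x - z).
    move=> Hx; rewrite lerBlDr -lerBlDl; apply: ub_le_sup; first exact: supS.2.
    by exists (x, a).
  have c2 x a : H (x, a) -> a + c <= q (x + z).
    by move=> Hx; rewrite -lerBrDl; apply: ge_sup => //; exact: Sub.
  pose H' : set (E * R) := [set w | exists x a r,
    H (x, a) /\ w = (x + of_real r *: z, a + r * c)].
  have HH' : H `<=` H'.
    move=> [x a] Hx; exists x, a, 0; split=> //.
    by rewrite of_real0 scale0r mul0r !addr0.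
  apply: (Gmax H').
    split; first by apply: subset_trans HH'; exact: subsetUl.
    move=> H'G; apply: (Hz c); left; apply: H'G; exists 0, 0, 1; split=> //.
    by rewrite of_real1 scale1r mul1r !add0r.
  rewrite /= (_ : H' `|` G0 = H'); last first.
    apply/seteqP; split=> w; last by left.
    by move=> [//|G0w]; apply: HH'; right.
  split.
    move=> _ _ r [x [a [s [Hx ->]]]] [y [b [t [Hy ->]]]] /=.
    exists (x + of_real r *: y), (a + r * b), (s + r * t); split.
      exact: (Hlin (x, a) (y, b)).
    by rewrite of_realD of_realM scalerDr scalerDl !scalerA !mulrDr !mulrDl
      !mulrA; congr (_, _); rewrite addrACA.
  move=> _ [x [a [r [Hx ->]]]] /=.
  have [r0|r0|->] := ltgtP r 0; last first.
  - by rewrite of_real0 scale0r mul0r !addr0; exact: (Hq _ Hx).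
  - have := c2 _ _ (HZ _ _ r^-1 Hx).
    rewrite -(ler_pM2l r0) mulrDr mulrA divff ?gt_eqF// mul1r => /le_trans; apply.
    rewrite -{1}(gtr0_norm r0) -(@modulus_of_real R k) -qZ scalerDr scalerA.
    by rewrite -of_realM divff ?gt_eqF// of_real1 scale1r.
  - have r0' : 0 < - r by rewrite oppr_gt0.
    have := c1 _ _ (HZ _ _ (- r)^-1 Hx).
    rewrite -(ler_pM2l r0') mulrBr mulrA divff ?gt_eqF// mul1r mulNr opprK.
    move=> /le_trans; apply.
    rewrite -{1}(gtr0_norm r0') -(@modulus_of_real R k) -qZ scalerBr scalerA.
    by rewrite -of_realM divff ?gt_eqF// of_real1 scale1r oN scaleNr opprK.
have [f Hf] := choice Htot; exists f; split.
- by move=> x y; apply: (Hfun (x + y)) => //; exact: HD.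
- by move=> r x; apply: (Hfun (of_real r *: x)) => //; exact: HZ.
- by move=> x; exact: (Hq _ (Hf x)).
- apply: (Hfun x0) => //; right; exists 1 => //.
  by rewrite of_real1 scale1r mul1r.
Qed.

End HahnBanach.

(** For complex scalars the real functional f is replaced by
x |-> f x - i f (i x); its modulus at x is the value of f at a rotation of x,
hence is still at most q x. *)
Lemma hahn_banach (R : realType) (k : scalar_kind) (E : tvsType (scalars R k))
    (q : E -> R) (x0 : E) : csnorm q ->
  exists2 f : dual E, forall x, modulus (f x) <= q x & modulus (f x0) = q x0.
Proof.
move=> cq; have [f [fD fZ fq f0]] := hahn_banach_real x0 (csnormD cq) (csnormZ cq).
have fN x : f (- x) = - f x.
  have := fZ (- 1) x; rewrite mulN1r => <-; congr f.
  rewrite -scaleN1r; congr (_ *: _).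
  by rewrite of_realN of_real1.
case: k E q x0 cq f fD fZ fq f0 fN => E q x0 cq f fD fZ fq f0 fN.
  have fq' x : `|f x| <= q x.
    by rewrite ler_norml fq andbT lerNl -fN (le_trans (fq _))// (csnormN cq).
  have lf : linear (f : E -> R^o) by move=> a x y; rewrite fD fZ.
  have [g gf] := csnorm_dual cq lf fq'.
  exists g => [x|]; first by rewrite gf; exact: fq'.
  by rewrite gf/= f0 ger0_norm// (csnorm_ge0 cq).
pose g (x : E) : R[i] := Complex (f x) (- f ('i%C *: x)).
have gD x y : g (x + y) = g x + g y.
  by rewrite /g scalerDr !fD opprD; simpc.
have gZ c x : g (c *: x) = c * g x.
  have fZc (a b : R) y : f (Complex a b *: y) = a * f y + b * f ('i%C *: y).
    have -> : Complex a b *: y = a%:C%C *: y + b%:C%C *: ('i%C *: y).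
      rewrite scalerA -scalerDl; congr (_ *: _).
      by rewrite /=; simpc.
    by rewrite fD !fZ.
  case: c => a b; rewrite /g scalerA.
  have -> : 'i%C * Complex a b = Complex (- b) a :> R[i] by simpc.
  (* fZc also matches its own right-hand side, hence the explicit arguments *)
  rewrite (fZc a b) (fZc (- b) a); apply/eqP; rewrite eq_complex/=.
  by apply/andP; split; apply/eqP; ring.
have lg : linear (g : E -> R[i]^o) by move=> a x y; rewrite gD gZ.
have gq x : modulus (g x : scalars R complex_scalars) <= q x.
  have [c c1 cg] := @unit_modulus_polar R complex_scalars (g x).
  have -> : modulus (g x : scalars R complex_scalars) = f (c *: x).
    by rewrite -[RHS]/(complex.Re (g (c *: x))) gZ cg.
  by apply: le_trans (fq _) _; rewrite (csnormZ cq) c1 mul1r.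
have [h hg] := csnorm_dual cq lg gq.
exists h => [x|]; first by rewrite hg; exact: gq.
apply/eqP; rewrite eq_le hg gq/= -f0.
have := (@modulus_Re_Im R (g x0)).1; apply: le_trans.
exact: ler_norm.
Qed.

(** * Weakly bounded sets are bounded *)

Section Mackey.
Context {R : realType} {k : scalar_kind}.
Local Notation K := (scalars R k).

Lemma cvg_modulus_le T (G : set_system T) (u : T -> K^o) (l c : K^o) (M : R) :
  ProperFilter G -> u @ G --> l -> G [set t | modulus (u t - c) <= M] ->
  modulus (l - c) <= M.
Proof.
move=> PG /cvg_modulusP ul GM; apply/ler_addgt0Pr => e e0.
have [t [/= ut lt]] := filter_ex (filterI GM (ul _ e0)).
rewrite -(subrK (u t) l) -addrA addrC (le_trans (ler_modulusD _ _))// lerD//.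
exact: ltW.
Qed.

(** The content of the Banach-Alaoglu theorem: linearity and domination survive
pointwise limits along an ultrafilter. *)
Lemma ultra_linear_lim (E : lmodType K) T (G : set_system T)
    (u : T -> E -> K^o) (M : E -> R) : UltraFilter G ->
  (forall t, linear (u t)) -> (forall x, G [set t | modulus (u t x) <= M x]) ->
  exists f : E -> K^o, [/\ linear f, forall x, u t x @[t --> G] --> f x &
    forall x, modulus (f x) <= M x].
Proof.
move=> UG ul uM; have PG : ProperFilter G by exact: ultra_proper.
have [f uf] := choice (fun x => ultra_cvg UG (uM x)).
exists f; split=> // [a x y|x]; last first.
  rewrite -[f x]subr0; apply: (cvg_modulus_le PG (uf x)).
  by apply: filterS (uM x) => t /=; rewrite subr0.
have ufl : u t (a *: x + y) @[t --> G] --> a *: f x + f y.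
  under eq_fun do rewrite ul.
  by apply: cvgD; [apply: cvgZl_tmp; exact: uf|exact: uf].
exact: (cvg_unique (@norm_hausdorff _ _) (uf _) ufl).
Qed.

(** Mackey's theorem.  If q were unbounded on B, choose y_n in B with q (y_n)
growing faster than 3^n and functionals psi_n dominated by q with
|psi_n (y_n)| = q (y_n).  The sums chi_n of the terms +- 3^-(n+1) psi_n converge
to a functional that is unbounded on B: the sign is chosen so that the new term
is not cancelled at y_n by the previous ones, and the later terms can undo at
most half of it, as the geometric series with ratio 1/3 shows. *)
Theorem weakly_bounded_csnorm (E : tvsType K) (B : set E) :
  (forall f : dual E, exists M : R, forall x, B x -> modulus (f x) <= M) ->
  forall q : E -> R, csnorm q -> exists M, forall x, B x -> q x <= M.
Proof.
move=> Bw q cq; apply: contrapT => /forallNP qB.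
have /choice[y yB] : forall n : nat, exists x,
    B x /\ 3 ^+ n.+1 * (2 * n%:R) < q x.
  move=> n; have /existsNP[x /not_implyP[Bx /negP]] :=
    qB (3 ^+ n.+1 * (2 * n%:R)).
  by rewrite -ltNge => qx; exists x.
have /choice[psi psiP] : forall n, exists f : dual E,
    (forall x, modulus (f x) <= q x) /\ modulus (f (y n)) = q (y n).
  by move=> n; have [f fq fy] := hahn_banach (y n) cq; exists f.
(* sizes of the terms of the series defining the functional *)
pose t n : R := 3^-1 ^+ n.
have t0 n : 0 < t n by rewrite exprn_gt0.
have tS n : t n.+1 = t n / 3 by rewrite /t exprSr.
pose inc n (c : E -> K^o) (s : K) : E -> K^o :=
  fun x => c x + s * (of_real (t n.+1) * psi n x).
pose step n (c : E -> K^o) : E -> K^o :=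
  if t n.+1 * q (y n) <= modulus (inc n c 1 (y n)) then inc n c 1
  else inc n c (- 1).
pose chi := fix chi n : E -> K^o :=
  if n is m.+1 then step m (chi m) else fun=> 0.
have chi_inc n : exists2 s, modulus s = 1 & chi n.+1 = inc n (chi n) s.
  rewrite /= /step; case: ifP => _; [exists 1|exists (- 1)] => //.
    by rewrite modulus1.
  by rewrite modulusN modulus1.
have chi_linear n : linear (chi n).
  elim: n => [|n IH] a x z; first by rewrite /= scaler0 addr0.
  have [s _ ->] := chi_inc n; rewrite /inc IH linearP.
  rewrite scalerDr addrACA mulrDr mulrDr; congr (_ + _ + _).
  by rewrite !scalerAr.
have chi_y n : t n.+1 * q (y n) <= modulus (chi n.+1 (y n)).
  rewrite /= /step; case: ifP => // /negbT; rewrite -ltNge => lt.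
  have [psiq psiy] := psiP n.
  have tq : modulus (of_real (t n.+1) * psi n (y n)) = t n.+1 * q (y n).
    by rewrite modulusM psiy modulus_of_real gtr0_norm.
  have : modulus (inc n (chi n) 1 (y n) - inc n (chi n) (- 1) (y n)) =
      2 * (t n.+1 * q (y n)).
    rewrite -tq -[2](@gtr0_norm R)// -(@modulus_of_real R k) -modulusM.
    congr modulus; rewrite /inc -[2](natrD _ 1 1) of_realD of_real1; ring.
  have := ler_modulusD (inc n (chi n) 1 (y n)) (- inc n (chi n) (- 1) (y n)).
  rewrite modulusN; lra.
have chi_step n x : modulus (chi n.+1 x - chi n x) <= t n.+1 * q x.
  have [s s1 ->] := chi_inc n; rewrite /inc addrAC subrr add0r !modulusM s1 mul1r.
  by rewrite modulus_of_real gtr0_norm// ler_wpM2l ?(psiP n).1// ltW.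
have chi_dist n d x : modulus (chi (n + d)%N x - chi n x) <=
    (t n - t (n + d)%N) / 2 * q x.
  elim: d => [|d IH]; first by rewrite addn0 !subrr modulus0 mul0r mul0r.
  rewrite -(subrK (chi (n + d)%N x) (chi _ x)) -addrA addnS.
  apply: (le_trans (ler_modulusD _ _)).
  have := chi_step (n + d)%N x; rewrite tS; move: IH.
  have := csnorm_ge0 cq x; lra.
have [G [UG sG]] := @ultraFilterLemma nat (nbhs \oo) _.
have PG : ProperFilter G by exact: ultra_proper.
have chiG n x : G [set m | modulus (chi m x - chi n x) <= t n / 2 * q x].
  apply: sG; exists n => // m /= nm; rewrite -(subnKC nm).
  apply: (le_trans (chi_dist _ _ _)); rewrite ler_wpM2r ?(csnorm_ge0 cq)//.
  by rewrite ler_wpM2r ?invr_ge0// gerBl ltW.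
have [f [lf chif fq]] : exists f : E -> K^o, [/\ linear f,
    forall x, chi m x @[m --> G] --> f x & forall x, modulus (f x) <= q x].
  apply: ultra_linear_lim => // x; apply: filterS (chiG 0%N x) => m /=.
  rewrite subr0 /t expr0 => /le_trans; apply.
  by rewrite ler_piMl ?(csnorm_ge0 cq)// mul1r invf_le1// ler1n.
have [g gf] := csnorm_dual cq lf fq.
have [M gM] := Bw g.
pose n := Num.bound `|M|.
have nM : M <= n%:R by rewrite (le_trans (ler_norm M))// ltW// archi_boundP.
have [By qy] := yB n.
have := gM _ By; rewrite gf; have := chi_y n.
have := cvg_modulus_le PG (chif (y n)) (chiG n.+1 (y n)).
have := ler_modulusD (chi n.+1 (y n) - f (y n)) (f (y n)).
rewrite subrK modulus_distC.
have : t n.+1 * (3 ^+ n.+1 * (2 * n%:R)) < t n.+1 * q (y n) by rewrite ltr_pM2l.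
rewrite mulrA /t -exprMn mulVf// expr1n mul1r.
set a := modulus _; set b := modulus _; set c := modulus (f _).
rewrite -/(t n.+1).
have -> : t n.+1 / 2 * q (y n) = (t n.+1 * q (y n)) / 2 by rewrite mulrAC.
set d := t _ * _; lra.
Qed.

End Mackey.

(** * Norms of sequences and power sums *)

Section EllNorms.
Context {R : realType} {k : scalar_kind}.
Local Notation K := (scalars R k).
Implicit Types (p : \bar R) (r C M : R) (a b : nat -> K^o).

Definition power_sum r a (N : nat) : R := \sum_(i < N) modulus (a i) `^ r.

Lemma power_sum_ge0 r a N : 0 <= power_sum r a N.
Proof. by apply: sumr_ge0 => i _; exact: powR_ge0. Qed.

Lemma power_sum_le r a (M N : nat) : (M <= N)%N -> power_sum r a M <= power_sum r a N.
Proof.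
move=> MN; rewrite /power_sum -!(big_mkord xpredT (fun i => modulus (a i) `^ r)).
by rewrite (big_cat_nat (leq0n M) MN)//= lerDl sumr_ge0// => i _; exact: powR_ge0.
Qed.

Lemma le_powR r x y : 0 < r -> 0 <= x -> 0 <= y -> (x `^ r <= y `^ r :> R) = (x <= y).
Proof.
move=> r0 x0 y0; apply/idP/idP; last by apply: ge0_ler_powR; rewrite ?nnegrE// ltW.
by apply: contraTT; rewrite -!ltNge; apply: gt0_ltr_powR; rewrite ?nnegrE.
Qed.

Lemma ell_norm_leP r a C : 1 <= r -> 0 <= C ->
  (ell_norm r%:E a <= C%:E)%E <-> forall N, power_sum r a N <= C `^ r.
Proof.
move=> r1 C0; have r0 : 0 < r := lt_le_trans ltr01 r1.
rewrite /ell_norm Lnorm_counting//; set S := (X in (X `^ _)%E).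
have S0 : (0 <= S)%E by apply: nneseries_ge0 => n _ _; exact: poweR_ge0.
have uE n : ((`|(EFin \o (modulus \o a)) n| `^ r) = (modulus (a n) `^ r)%:E)%E.
  by rewrite /= ger0_norm// modulus_ge0.
have SE N : (power_sum r a N)%:E =
    (\sum_(0 <= n < N) (`|(EFin \o (modulus \o a)) n| `^ r))%E.
  rewrite big_mkord /power_sum -sumEFin; apply: eq_bigr => i _.
  by rewrite uE.
have -> : (S `^ r^-1 <= C%:E)%E <-> (S <= (C `^ r)%:E)%E.
  split=> SC.
    have -> : S = ((S `^ r^-1) `^ r)%E.
      by rewrite -poweRrM mulVf ?gt_eqF// poweRe1.
    rewrite -poweR_EFin; apply: gt0_ler_poweR => //; first exact: ltW.
      by rewrite in_itv/= poweR_ge0 leey.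
    by rewrite in_itv/= lee_fin C0 leey.
  have -> : C = (C `^ r) `^ r^-1 by rewrite -powRrM mulfV ?gt_eqF// powRr1.
  rewrite -poweR_EFin; apply: gt0_ler_poweR => //; first by rewrite invr_ge0 ltW.
    by rewrite in_itv/= S0 leey.
  by rewrite in_itv/= lee_fin powR_ge0 leey.
split=> H.
  move=> N; rewrite -lee_fin SE; apply: le_trans H.
  by apply: nneseries_lim_ge => n _ _; exact: poweR_ge0.
apply: lime_le.
  by apply: is_cvg_nneseries => n _ _; exact: poweR_ge0.
by apply: nearW => N; rewrite -SE lee_fin.
Qed.

Lemma ell_memP r a : 1 <= r ->
  ell_mem r%:E a <-> exists M, forall N, power_sum r a N <= M.
Proof.
move=> r1; have r0 : 0 < r := lt_le_trans ltr01 r1; split=> [am|[M aM]].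
  have afin : ell_norm r%:E a \is a fin_num.
    by rewrite ge0_fin_numE ?ell_norm_ge0.
  exists (fine (ell_norm r%:E a) `^ r) => N.
  apply: (iffLR (ell_norm_leP a r1 _)); first by rewrite fine_ge0// ell_norm_ge0.
  by rewrite fineK.
have M0 : 0 <= M by exact: le_trans (power_sum_ge0 r a 0) (aM 0%N).
apply: (@le_lt_trans _ _ (M `^ r^-1)%:E); last exact: ltry.
apply/ell_norm_leP => // [|N]; first exact: powR_ge0.
by rewrite -powRrM mulVf ?gt_eqF// powRr1.
Qed.

Lemma ell_normy_leP a C : 0 <= C ->
  (ell_norm +oo a <= C%:E)%E <-> forall n, modulus (a n) <= C.
Proof.
move=> C0; rewrite /ell_norm unlock /Lnorm; case: ifPn => [_|]; last first.
  move=> /negP; case; rewrite (@lt_le_trans _ _ (@counting nat R [set 0%N]))//.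
    by rewrite /counting asboolT// fset_set1 finmap.cardfs1 lte_fin ltr01.
  by apply: le_measure => //; rewrite inE.
split=> [/ess_supP[N [_ N0 aN]] n|aC].
  have {}N0 : N = set0.
    have {}N0 : @counting nat R N = 0%E by [].
    move: N0; rewrite /counting.
    have [finN /eqP|//] := asboolP.
    by rewrite eqe pnatr_eq0 finmap.cardfs_eq0 => /eqP h; exact: fset_set_set0 h.
  apply: contrapT => /negP; rewrite -ltNge => Ca.
  have : N n by apply: aN => /=; rewrite lee_fin ger0_norm ?modulus_ge0// leNgt Ca.
  by rewrite N0.
apply/ess_supP/nearW => n /=; rewrite lee_fin ger0_norm ?modulus_ge0//.
Qed.

Lemma ell_space_normP p (p1 : (1 <= p)%E) (S : ell_sub (k := k) p)
    (a : ell_space p1 S) C :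
  modulus (`|a| : K) <= C <-> (ell_norm p (\val a) <= C%:E)%E.
Proof.
have am : ell_mem p (\val a).
  by apply: (@ell_carrier_mem _ _ _ S); have /asboolP := valP a.
have fin : ell_norm p (\val a) \is a fin_num.
  by rewrite ge0_fin_numE ?ell_norm_ge0.
rewrite -[`|a|]/(of_real (fine (ell_norm p (\val a)))) modulus_of_real.
by rewrite ger0_norm ?fine_ge0 ?ell_norm_ge0// -lee_fin fineK.
Qed.

Lemma power_sum_subseq r a (s : nat -> nat) N : strictly_increasing s ->
  power_sum r (a \o s) N <= power_sum r a (s N).
Proof.
move=> sinc; elim: N => [|N IH]; first by rewrite /power_sum big_ord0 power_sum_ge0.
apply: (@le_trans _ _ (power_sum r a (s N).+1)); last exact/power_sum_le/sinc.
by rewrite /power_sum !big_ord_recr/= lerD2r.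
Qed.

Lemma power_sumZ (s : R) (c : K) (a : nat -> K^o) N :
  power_sum s (fun i => c * a i) N = modulus c `^ s * power_sum s a N.
Proof.
rewrite /power_sum mulr_sumr; apply: eq_bigr => i _.
by rewrite modulusM powRM ?modulus_ge0.
Qed.

Lemma power_sum_window (s : R) (a : nat -> K^o) m n : 0 < s -> (m <= n)%N ->
  power_sum s (fun i => if (m <= i)%N then a i else 0) n =
  power_sum s a n - power_sum s a m.
Proof.
move=> s0 mn; rewrite /power_sum.
rewrite -(big_mkord xpredT (fun i => modulus (if (m <= i)%N then a i else 0) `^ s)).
rewrite -(big_mkord xpredT (fun i => modulus (a i) `^ s)).
rewrite -(big_mkord xpredT (fun i => modulus (a i) `^ s)).
rewrite [in RHS](big_cat_nat (leq0n m) mn)/= addrAC subrr add0r.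
rewrite (big_cat_nat (leq0n m) mn)/= big_nat big1 ?add0r => [|i /andP[_ im]].
  by rewrite big_nat [RHS]big_nat; apply: eq_bigr => i /andP[-> _].
by rewrite leqNgt im/= modulus0 powR0// gt_eqF.
Qed.

Lemma power_sum_unit (s : R) n N : 0 < s -> power_sum s (@unit_seq R k n) N <= 1.
Proof.
move=> s0; have sn0 : s != 0 by rewrite gt_eqF.
rewrite /power_sum; have [nN|Nn] := ltnP n N.
  rewrite (bigD1 (Ordinal nN))//= big1 => [|i /eqP iN].
    by rewrite addr0 /unit_seq eqxx modulus1 powR1.
  rewrite /unit_seq; case: eqP => [ni|]; last by rewrite modulus0 powR0.
  by case: iN; exact: val_inj.
rewrite big1// => i _; rewrite /unit_seq ltn_eqF ?modulus0 ?powR0//.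
exact: leq_trans (ltn_ord i) Nn.
Qed.

Lemma ell_power_sum_le (s : R) (s1 : (1 <= s%:E)%E) (a : ell k s1) N :
  power_sum s (\val a) N <= modulus (`|a| : K) `^ s.
Proof.
have /(ell_space_normP a) := lexx (modulus (`|a| : K)).
by move=> /(ell_norm_leP _ s1 (modulus_ge0 _)).
Qed.

Lemma ell_build (s : R) (s1 : (1 <= s%:E)%E) (a : nat -> K^o) :
  ell_mem s%:E a -> exists b : ell k s1, \val b = a.
Proof.
move=> sa; have am : a \in ell_sub_pred (ell_full k s1) by apply/asboolP.
by exists (Sub a am : ell_space s1 (ell_full k s1)).
Qed.

End EllNorms.

(** * Subsequences *)

Section Subsequences.

Lemma strictly_increasing_comp s t : strictly_increasing s ->
  strictly_increasing t -> strictly_increasing (s \o t).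
Proof. by move=> si ti m n mn; apply: si; exact: ti. Qed.

Lemma strictly_increasing_ge s n : strictly_increasing s -> (n <= s n)%N.
Proof. by move=> si; elim: n => // n IH; apply: leq_ltn_trans IH _; exact: si. Qed.

Lemma near_subseq s (P : nat -> Prop) : strictly_increasing s ->
  (\forall n \near \oo, P n) -> \forall n \near \oo, P (s n).
Proof.
move=> si [N _ NP]; exists N => // n /= Nn; apply: NP => /=.
exact: leq_trans Nn (strictly_increasing_ge n si).
Qed.

Lemma cvg_subseq (T : topologicalType) (u : nat -> T) (l : T) s :
  strictly_increasing s -> u @ \oo --> l -> (u \o s) @ \oo --> l.
Proof. by move=> si ul A /ul; exact: near_subseq. Qed.

(** Dependent choice, for extracting several indices at once when each step is
constrained by the previous one. *)
Lemma extract_chain (S : Type) (next : S -> S -> Prop) (P : nat -> S -> Prop) (s0 : S) :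
  (forall n s, exists2 s', next s s' & P n s') ->
  exists2 sigma : nat -> S, forall n, next (sigma n) (sigma n.+1) &
    forall n, P n (sigma n).
Proof.
move=> H; have {H}/choice[g gP] : forall ns : nat * S,
    exists s', next ns.2 s' /\ P ns.1 s'.
  by move=> [n s]; have [s' ss' Ps'] := H n s; exists s'.
pose sigma := fix sigma n := if n is m.+1 then g (m.+1, sigma m) else g (0%N, s0).
exists sigma => [n|[|n]]; first exact: (gP (n.+1, sigma n)).1.
- exact: (gP (0%N, s0)).2.
- exact: (gP (n.+1, sigma n)).2.
Qed.

Lemma strictly_increasing_step s : (forall n, (s n < s n.+1)%N) ->
  strictly_increasing s.
Proof. by move=> ss; apply: homo_ltn => // y x z; exact: ltn_trans. Qed.

Lemma extract_subseq (P : nat -> nat -> Prop) :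
  (forall k N, exists2 n, (N <= n)%N & P k n) ->
  exists2 s, strictly_increasing s & forall k, P k (s k).
Proof.
move=> H; have [n m|s ss sP] := @extract_chain nat (fun m n => (m < n)%N) P 0%N.
  by have [m' mm' Pm'] := H n m.+1; exists m'.
by exists s => //; exact: strictly_increasing_step.
Qed.

Lemma not_near_subseq (P : nat -> Prop) : ~ (\forall n \near \oo, P n) ->
  exists2 s, strictly_increasing s & forall n, ~ P (s n).
Proof.
move=> nP; apply: (@extract_subseq (fun _ n => ~ P n)) => _ N.
apply: contrapT => H; apply: nP; exists N => // n /= Nn.
by apply: contrapT => nPn; apply: H; exists n.
Qed.

End Subsequences.

(** * Weakly summable sequences and limited sets *)

Section Summability.
Context {R : realType} {k : scalar_kind}.
Local Notation K := (scalars R k).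
Implicit Types (p : \bar R) (a b : nat -> K^o).

Lemma p_summable_fin (r : R) a : p_summable r%:E a = ell_mem r%:E a.
Proof. by []. Qed.

Lemma p_summableB p a b : (1 <= p)%E -> p_summable p a -> p_summable p b ->
  p_summable p (fun n => a n - b n).
Proof.
move=> p1; rewrite /p_summable; case: ifP => _ ha hb.
  by rewrite -[0 : K^o]subr0; exact: cvgB.
have -> : (fun n => a n - b n) = a + (- 1) *: b.
  by apply/funext => n; rewrite !fctE scaleN1r.
by apply: ell_memD => //; exact: ell_memZ.
Qed.

Lemma p_summable_subseq p a s : (1 <= p)%E -> strictly_increasing s ->
  p_summable p a -> p_summable p (fun n => a (s n)).
Proof.
move=> p1 si; rewrite /p_summable; case: eqP => [_|]; first exact: cvg_subseq.
case: p p1 => [r|//|//]; rewrite lee_fin => r1 _ /(ell_memP _ r1)[M aM].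
apply/ell_memP => //; exists M => N.
exact: le_trans (power_sum_subseq _ _ _ si) (aM _).
Qed.

Lemma p_summable0 p : (1 <= p)%E -> p_summable p (fun=> 0 : K^o).
Proof.
move=> p1; rewrite /p_summable; case: ifP => _; first exact: cvg_cst.
exact: (ell_mem0 p1).
Qed.

Lemma p_summable_null p a : (1 <= p)%E -> p_summable p a ->
  a @ \oo --> (0 : K^o).
Proof.
move=> p1; rewrite /p_summable; case: eqP => [//|].
case: p p1 => [r|//|//]; rewrite lee_fin => r1 _ /(ell_memP _ r1)[M aM].
have r0 : 0 < r := lt_le_trans ltr01 r1.
have cv : cvgn (series (fun n => modulus (a n) `^ r)).
  apply: nondecreasing_is_cvgn.
    by apply: nondecreasing_series => n _ _; exact: powR_ge0.
  by exists M => _ [N _ <-]; rewrite /series/= big_mkord; exact: aM.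
apply/cvg_modulusP => e e0.
have er0 : 0 < e `^ r by rewrite powR_gt0.
have /cvgrPdist_lt/(_ _ er0) := cvg_series_cvg_0 cv.
apply: filterS => n; rewrite !sub0r normrN modulusN ger0_norm ?powR_ge0// => lt.
by rewrite ltNge -(le_powR r0) ?modulus_ge0 ?(ltW e0)// -ltNge.
Qed.

Lemma weakly_p_summable_subseq p (E : tvsType K) (x : nat -> E) s : (1 <= p)%E ->
  strictly_increasing s -> weakly_p_summable p x -> weakly_p_summable p (x \o s).
Proof. by move=> p1 si xp f; by apply: (p_summable_subseq (a := fun n => f (x n))). Qed.

Lemma weakly_p_convergent_cauchy p (E : tvsType K) (x : nat -> E) l :
  (1 <= p)%E -> weakly_p_convergent p x l -> weakly_p_cauchy p x.
Proof.
move=> p1 xl i j si sj f.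
have -> : (fun n => f (x (i n) - x (j n))) =
    (fun n => f (x (i n) - l) - f (x (j n) - l)).
  by apply/funext => n; rewrite -linearB opprB addrA subrK.
by apply: p_summableB => //; apply: (p_summable_subseq (a := fun n => f (x n - l)));
  rewrite //; exact: xl.
Qed.

Lemma weakstar_nullP (E : tvsType K) (f : nat -> weakstar_dual E) :
  weakstar_null f <-> forall x (e : R), 0 < e ->
    \forall n \near \oo, modulus (f n x) < e.
Proof.
rewrite /weakstar_null weakstar_cvgP; split=> H x.
  move=> e e0; have /cvg_modulusP/(_ _ e0) := H x.
  by apply: filterS => n; rewrite sub0r modulusN.
apply/cvg_modulusP => e e0; apply: filterS (H x e e0) => n.
by rewrite sub0r modulusN.
Qed.

Lemma weakstar_null_subseq (E : tvsType K) (f : nat -> weakstar_dual E) s :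
  strictly_increasing s -> weakstar_null f -> weakstar_null (f \o s).
Proof. exact: cvg_subseq. Qed.

Lemma limitedP (E : tvsType K) (A : set E) : limited A <-> A !=set0 /\
  forall f : nat -> weakstar_dual E, weakstar_null f -> forall e : R, 0 < e ->
    \forall n \near \oo, forall x, A x -> modulus (f n x) <= e.
Proof.
split=> -[A0 H]; split=> // f /H {}H.
  move=> e e0; have : nbhs 0%E [set y : \bar R | (y < e%:E)%E].
    have : nbhs (0 : R) [set y | y < e] by exact: lt_nbhsl.
    by apply: filterS => y; rewrite /= lte_fin.
  move=> /H/=; apply: (@filterS _ (nbhs \oo)) => n /= lt x Ax.
  rewrite -lee_fin; apply: ltW; apply: le_lt_trans lt.
  by apply: ereal_sup_ubound; exists x.
move=> U /= U0; have [e /= e0 eU] : exists2 e : R, 0 < e &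
    forall y, `|y| < e -> U y%:E.
  have /nbhs_ballP[e /= e0 eU] : nbhs (0 : R) (fun y => U y%:E) by exact: U0.
  exists e => // y ye.
  by apply: eU; rewrite -ball_normE/= sub0r normrN.
have e2 : 0 < e / 2 by rewrite divr_gt0.
apply: (@filterS _ (nbhs \oo)) (H _ e2) => n Hn; rewrite /=.
set s := ereal_sup [set _ | _ in _].
have s_le : (s <= (e / 2)%:E)%E.
  by apply: ge_ereal_sup => _ [x Ax <-]; rewrite lee_fin; exact: Hn.
have s_ge : (0 <= s)%E.
  have [x Ax] := A0; apply: (@le_trans _ _ (modulus (f n x))%:E).
    by rewrite lee_fin modulus_ge0.
  by apply: ereal_sup_ubound; exists x.
rewrite /=; case: s s_le s_ge => // s; rewrite !lee_fin => s_le s_ge.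
apply: eU; rewrite ger0_norm// (le_lt_trans s_le)// ltr_pdivrMr// ltr_pMr//.
by rewrite ltr1n.
Qed.

End Summability.

(** * Limited images of precompact sets *)

Section LimitedImages.
Context {R : realType} {k : scalar_kind}.
Local Notation K := (scalars R k).
Context {p : \bar R} (p1 : (1 <= p)%E) {E L : tvsType K} (T : operator E L).

(** Otherwise |f_n (T a_n)| > e along a sequence that may be assumed weakly
p-Cauchy.  For each n the values f_m (T a_n) tend to 0 as m grows, so j n can be
chosen with |f_(j n) (T a_n)| < e / 2; then f_(j n) is at least e / 2 in modulus
on the image of a_(j n) - a_n, and these differences are weakly p-summable. *)
Lemma weakstar_p_convergent_precompact (A : set E) :
  weakstar_p_convergent p T -> A !=set0 -> weakly_seq_p_precompact p A ->
  limited (T @` A).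
Proof.
move=> Tp A0 Ap; apply/limitedP; split=> [|f f0 e e0].
  by have [a Aa] := A0; exists (T a), a.
apply: contrapT => /not_near_subseq[s si sP].
have /choice[a aP] : forall n, exists a, A a /\ e < modulus (f (s n) (T a)).
  move=> n; have /existsNP[_ /not_implyP[[a Aa <-] /negP]] := sP n.
  by rewrite -ltNge => lt; exists a.
have [i ii ai] := Ap a (fun n => (aP n).1).
have gi := strictly_increasing_comp si ii.
have g0 := weakstar_null_subseq gi f0; set g := f \o _ in g0.
have e2 : 0 < e / 2 by rewrite divr_gt0.
have [n N|j ji jP] := @extract_subseq
    (fun n m => modulus (g m (T (a (i n)))) < e / 2).
  have [M _ MP] := (weakstar_nullP g).1 g0 (T (a (i n))) _ e2.
  by exists (maxn N M); [exact: leq_maxl|apply: MP => /=; exact: leq_maxr].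
have := Tp _ _ (weakstar_null_subseq ji g0) (ai j id ji (fun _ _ => id)).
move=> /cvg_modulusP/(_ _ e2)[N _ /(_ N (leqnn N))].
rewrite /= sub0r modulusN (linearB T) linearB => lt.
have := (aP (i (j N))).2; have := jP N; rewrite -/(g (j N)) => lt1 lt2.
have := ler_modulusD (g (j N) (T (a (i (j N)))) - g (j N) (T (a (i N))))
  (g (j N) (T (a (i N)))).
rewrite subrK; move: lt lt1 lt2; rewrite /g/=; lra.
Qed.

Lemma relatively_compact_precompact (A : set E) :
  relatively_weakly_seq_p_compact p A -> weakly_seq_p_precompact p A.
Proof.
move=> Ap x Ax; have [i ii [l xl]] := Ap x Ax.
by exists i => //; exact: weakly_p_convergent_cauchy xl.
Qed.

Lemma compact_relatively_compact (A : set E) :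
  weakly_seq_p_compact p A -> relatively_weakly_seq_p_compact p A.
Proof.
by move=> Ap x Ax; have [i ii [l _ xl]] := Ap x Ax; exists i => //; exists l.
Qed.

Lemma weakly_p_summable0 : weakly_p_summable p (fun=> 0 : E).
Proof.
move=> f; have -> : (fun=> f 0) = (fun=> 0 : K^o) :> (nat -> K^o).
  by apply/funext => _; rewrite linear0.
exact: p_summable0.
Qed.

Lemma pigeonhole_subseq (U : choiceType) (u : nat -> U) (l : seq U) :
  (\forall n \near \oo, u n \in l) ->
  exists2 v, v \in l & exists2 s, strictly_increasing s & forall n, u (s n) = v.
Proof.
elim: l => [|v l IH] ul.
  by have [n] := filter_ex ul.
have [nv|/not_near_subseq[s si sv]] := pselect (\forall n \near \oo, u n <> v).
  have [|w wl H] := IH.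
    apply: filterS2 ul nv => n; rewrite inE => /orP[/eqP//|//].
  by exists w => //; rewrite inE wl orbT.
exists v; rewrite ?mem_head//; exists s => // n.
by apply: contrapT; exact: sv.
Qed.

(** A sequence in the set runs through x_m with unboundedly many m, or takes the
value 0 infinitely often, or takes one of finitely many values infinitely
often.  In the first case m can be made increasing, and in the other two a
subsequence is constant. *)
Lemma p_summable_range_compact (x : nat -> E) : weakly_p_summable p x ->
  weakly_seq_p_compact p (range x `|` [set 0]).
Proof.
move=> xp u uA.
(* either every x m is eventually avoided, or one finite set recurs *)
have [H|/existsNP[N /not_near_subseq H]] :=
  pselect (forall N, \forall n \near \oo, forall m, u n = x m -> (N <= m)%N).
- have [n0|/not_near_subseq[s si sP]] := pselect (\forall n \near \oo, u n <> 0).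
    have [ms ms'|sg sglt sgP] := @extract_chain (nat * nat)
        (fun a b => (a.1 < b.1)%N /\ (a.2 < b.2)%N)
        (fun _ a => u a.1 = x a.2) (0%N, 0%N).
      have [n [[nm n0'] nms]] :=
        filter_ex (filterI (filterI (H ms'.2.+1) n0) (nbhs_infty_gt ms'.1)).
      have [[m _ xm]|//] := uA n.
      by exists (n, m) => //=; split => //; exact: nm.
    exists (fst \o sg).
      by apply: strictly_increasing_step => n; have [] := sglt n.
    exists 0; first by right.
    have si : strictly_increasing (snd \o sg).
      by apply: strictly_increasing_step => n; have [] := sglt n.
    rewrite /weakly_p_convergent (_ : (fun n => _) = x \o (snd \o sg)).
      exact: weakly_p_summable_subseq.
    by apply/funext => n /=; rewrite subr0 sgP.
  exists s => //; exists 0; first by right.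
  rewrite /weakly_p_convergent (_ : (fun n => _) = fun=> 0).
    exact: weakly_p_summable0.
  by apply/funext => n /=; rewrite subr0; apply: contrapT; exact: sP.
- have [s si sP] := H.
  have [|v vl [t ti tv]] := @pigeonhole_subseq _ (u \o s) [seq x i | i <- iota 0 N].
    apply: nearW => n /=; have /existsNP[m /not_implyP[-> /negP]] := sP n.
    by rewrite -ltnNge => mN; apply: map_f; rewrite mem_iota.
  exists (s \o t); first exact: strictly_increasing_comp.
  exists v; first by left; move: vl => /mapP[i _ ->]; exists i.
  rewrite /weakly_p_convergent (_ : (fun n => _) = fun=> 0).
    exact: weakly_p_summable0.
  by apply/funext => n /=; rewrite [u _]tv subrr.
Qed.

Lemma limited_subset (A B : set L) : A !=set0 -> A `<=` B -> limited B -> limited A.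
Proof.
move=> A0 AB /limitedP[_ H]; apply/limitedP; split=> // f f0 e e0.
by apply: filterS (H f f0 e e0) => n fB x /AB; exact: fB.
Qed.

Lemma limited_ranges_weakstar_p_convergent :
  (forall x : nat -> E, weakly_p_summable p x -> limited (T @` range x)) ->
  weakstar_p_convergent p T.
Proof.
move=> H f x f0 /H/limitedP[_ /(_ f f0) {}H].
apply/cvg_modulusP => e e0.
have e2 : 0 < e / 2 by rewrite divr_gt0.
apply: filterS (H _ e2) => n fn; rewrite sub0r modulusN.
apply: (@le_lt_trans _ _ (e / 2)); last first.
  by rewrite ltr_pdivrMr// ltr_pMr// ltr1n.
by apply: fn; exists (x n) => //; exists n.
Qed.

End LimitedImages.

(** * Limited operators and their adjoints *)

Section StrongDual.
Context {R : realType} {k : scalar_kind}.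
Local Notation K := (scalars R k).

(** Evaluations are continuous on the weak-star dual, and all its functionals are
continuous; this settles both directions without identifying the bidual. *)
Lemma weakly_summable_weakstar_null (L : tvsType K) (f : nat -> weakstar_dual L) :
  weakly_p_summable +oo%E f <-> weakstar_null f.
Proof.
split=> [fs|f0 g]; last first.
  rewrite /p_summable eqxx.
  have -> : (0 : K^o) = g 0 by rewrite linear0.
  by apply: continuous_cvg f0; exact: operator_continuous.
apply/weakstar_cvgP => x.
pose ev (g : weakstar_dual L) : K^o := g x.
have lev : linear ev by [].
have cev : continuous ev.
  move=> g A /nbhs_ballP[e /= e0 eA]; apply/polar_nbhsP.
  exists [set x], (e / 2); split=> [||h /(_ x erefl) gh].
  - exact: finite_set1.
  - by rewrite divr_gt0.
  apply: eA; rewrite -ball_normE/= (le_lt_trans gh)//.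
  by rewrite ltr_pdivrMr// ltr_pMr// ltr1n.
have := fs (Sub ev (operator_mem lev cev)).
by rewrite /p_summable eqxx.
Qed.

Lemma ball_bounded (X : normedModType K) : von_neumann_bounded (ball (0 : X) 1).
Proof.
move=> U /nbhs_ballP[e /= e0 eU]; exists e^-1; rewrite ?invr_gt0// => s es b.
rewrite -ball_normE/= sub0r normrN => b1.
have s0 : 0 < `|s| by rewrite (lt_le_trans _ es)// invr_gt0.
exists (s^-1 *: b); last by rewrite scalerA divff ?scale1r// -normr_gt0.
apply: eU; rewrite -ball_normE/= sub0r normrN normrZ normfV.
rewrite mulrC ltr_pdivrMr//; apply: (lt_le_trans b1).
by rewrite -(@ler_pM2l _ e^-1) ?invr_gt0// mulr1 mulKf ?gt_eqF.
Qed.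

Context {E L X : tvsType K}.

(** A bounded set is absorbed by the neighbourhood whose image is limited. *)
Lemma limited_map_adjoint (T : operator E L) (Q : operator X E) :
  limited_map (T \o Q) -> p_convergent +oo%E
    (fun f : weakstar_dual L => adjoint Q (adjoint T f) : strong_dual X).
Proof.
move=> [U U0 /limitedP[_ TU]] f /weakly_summable_weakstar_null/TU {}TU.
apply/polar_cvgP => B bB e e0; have [r r0 rB] := bB U U0.
have [eE me0] := gt0_of_real e0; have [rE mr0] := gt0_of_real r0.
have er0 : 0 < modulus e / modulus r by rewrite divr_gt0.
apply: (@filterS _ (nbhs \oo)) (TU _ er0) => n fn b Bb.
have rr : r <= `|r| by rewrite gtr0_norm.
have [u Uu <-] := rB r rr b Bb.
rewrite eE -modulusE ler_of_real.
rewrite -[X in modulus X](_ : - polar_dual_fun (f n) (T (Q (r *: u))) = _).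
  rewrite modulusN !linearZ modulusM mulrC -ler_pdivlMr//.
  by apply: fn; exists u.
exact/esym/sub0r.
Qed.

End StrongDual.

(** The unit ball is both a bounded set and a neighbourhood of 0. *)
Lemma adjoint_limited_map {R : realType} {k : scalar_kind}
    (E L : tvsType (scalars R k)) (X : normedModType (scalars R k))
    (T : operator E L) (Q : operator X E) : p_convergent +oo%E
    (fun f : weakstar_dual L => adjoint Q (adjoint T f) : strong_dual X) ->
  limited_map (T \o Q).
Proof.
move=> H; exists (ball 0 1); first exact: nbhsx_ballx.
apply/limitedP; split=> [|f f0 e e0].
  by exists (T (Q 0)), 0 => //; exact: ballxx.
have /weakly_summable_weakstar_null := f0.
move=> /H /polar_cvgP/(_ _ (@ball_bounded _ _ X) (of_real e)).
rewrite -[in X in X -> _](@of_real0 R k) ltr_of_real => /(_ e0).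
apply: (@filterS _ (nbhs \oo)) => n fn _ [b bb <-].
rewrite -(@ler_of_real R k) modulusE; have := fn b bb; apply: le_trans.
rewrite -[X in _ <= `|X|](_ : - polar_dual_fun (f n) (T (Q b)) = _) ?normrN//.
exact/esym/sub0r.
Qed.

(** * The Banach space of null sequences *)

Section NullSequences.
Context {R : realType} {k : scalar_kind}.
Local Notation K := (scalars R k).
Local Notation c0 := (c0 R k).

Lemma c0_normP (a : c0) (C : R) : 0 <= C ->
  modulus (`|a| : K) <= C <-> forall n, modulus (\val a n) <= C.
Proof. by move=> C0; rewrite ell_space_normP; exact: ell_normy_leP. Qed.

Lemma c0_coord (a : c0) n : modulus (\val a n) <= modulus (`|a| : K).
Proof. exact: (iffLR (c0_normP a (modulus_ge0 _))). Qed.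

Lemma c0_null (a : c0) : \val a @ \oo --> (0 : K^o).
Proof. by have /asboolP := valP a. Qed.

Lemma c0_build (a : nat -> K^o) : a @ \oo --> (0 : K^o) ->
  exists b : c0, \val b = a.
Proof.
move=> a0; have am : a \in ell_sub_pred (null_sub R k) by apply/asboolP.
by exists (Sub a am : ell_space (leey 1%E) (null_sub R k)).
Qed.

Lemma c0_valD (a b : c0) n : \val (a + b) n = \val a n + \val b n.
Proof. by []. Qed.

Lemma c0_valZ c (a : c0) n : \val (c *: a) n = c * \val a n.
Proof. by []. Qed.

Lemma c0_valB (a b : c0) n : \val (a - b) n = \val a n - \val b n.
Proof. by []. Qed.

Lemma c0_val_sum I (r : seq I) (F : I -> c0) n :
  \val (\sum_(i <- r) F i) n = \sum_(i <- r) \val (F i) n.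
Proof.
elim: r => [|i r IH]; first by rewrite !big_nil.
by rewrite !big_cons c0_valD IH.
Qed.

Lemma c0_ext (a b : c0) : (forall n, \val a n = \val b n) -> a = b.
Proof. by move=> ab; apply: val_inj; apply/funext. Qed.

(** The functionals f_n are the coordinates of an operator into c_0; domination by
one seminorm is what makes it continuous. *)
Lemma c0_operator (L : tvsType K) (f : nat -> weakstar_dual L) (q : L -> R) :
  weakstar_null f -> csnorm q -> (forall n y, modulus (f n y) <= q y) ->
  exists S : operator L c0, forall y n, \val (S y) n = f n y.
Proof.
move=> f0 cq fq.
have /choice[S SE] : forall y, exists b : c0, \val b = (fun n => f n y : K^o).
  move=> y; apply: c0_build; apply/cvg_modulusP => e e0.
  apply: filterS ((weakstar_nullP f).1 f0 y e e0) => n.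
  by rewrite sub0r modulusN.
have lS : linear S.
  move=> a x y; apply: c0_ext => n.
  by rewrite c0_valD c0_valZ !SE linearP.
have cS : continuous S.
  apply: linear_continuous_csnorm => // U /nbhs0_normP[r r0 rU].
  exists (fun x => (2 / r) * q x).
    by apply: csnorm_mul => //; rewrite divr_ge0// ltW.
  move=> x qx; apply: rU; apply: (@le_lt_trans _ _ (r / 2)).
    apply/c0_normP => [|n]; first by rewrite divr_ge0// ltW.
    rewrite SE (le_trans (fq n x))//.
    by rewrite -[r / 2]invf_div -[leRHS]mul1r ler_pdivlMr ?divr_gt0// mulrC ltW.
  by rewrite ltr_pdivrMr// ltr_pMr// ltr1n.
by exists (Sub S (operator_mem lS cS)) => y n; exact: (congr1 (fun a => a n) (SE y)).
Qed.

(** The coordinates of the limit are taken along an ultrafilter refining F; the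
Cauchy estimate is uniform in the coordinates, so it passes to the limit and
gives both membership in c_0 and convergence in norm. *)
Lemma c0_complete (F : set_system c0) : ProperFilter F -> cauchy F -> cvg F.
Proof.
move=> PF /cauchyP Fc.
have FA (e : R) : 0 < e -> exists2 A, F A & forall a b, A a -> A b ->
    forall n, modulus (\val a n - \val b n) <= e.
  move=> e0; have e2 : 0 < of_real (e / 2) :> K.
    by rewrite -(@of_real0 R k) ltr_of_real divr_gt0.
  have [x Fx] := Fc _ e2; exists (ball x (of_real (e / 2))) => // a b.
  rewrite -ball_normE/= => xa xb n; rewrite -c0_valB.
  apply: (le_trans (c0_coord _ _)).
  rewrite -(@ler_of_real R k) modulusE normr_id.
  rewrite -(subrKA x a (- b)) (le_trans (ler_normD _ _))//.
  by rewrite [e]splitr of_realD lerD ?ltW// distrC.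
have [G [UG FG]] := ultraFilterLemma PF.
have PG : ProperFilter G by exact: ultra_proper.
have /choice[l lP] : forall n, exists l : K^o, \val a n @[a --> G] --> l.
  move=> n; have [A FA1 AP] := FA _ ltr01; have [x Ax] := filter_ex FA1.
  apply: (ultra_cvg (M := modulus (\val x n) + 1) UG).
  apply: FG; apply: filterS FA1 => a Aa /=.
  rewrite -(subrK (\val x n) (\val a n)) (le_trans (ler_modulusD _ _))//.
  by rewrite addrC lerD2l; exact: AP.
have FAl (e : R) : 0 < e -> exists2 A, F A & forall a, A a ->
    forall n, modulus (l n - \val a n) <= e.
  move=> e0; have [A FA' AP] := FA e e0; exists A => // a Aa n.
  apply: (cvg_modulus_le PG (lP n)); apply: FG.
  by apply: filterS FA' => b Ab /=; exact: AP.
have l0 : l @ \oo --> (0 : K^o).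
  apply/cvg_modulusP => e e0; have e2 : 0 < e / 2 by rewrite divr_gt0.
  have [A FA' AP] := FAl _ e2; have [a Aa] := filter_ex FA'.
  have /cvg_modulusP/(_ _ e2) := c0_null a; apply: filterS => n.
  rewrite !sub0r !modulusN => an; rewrite -(subrK (\val a n) (l n)).
  by rewrite (le_lt_trans (ler_modulusD _ _))// [e]splitr ler_ltD// AP.
have [b bl] := c0_build l0.
apply/cvg_ex; exists b => U /nbhs_translate/nbhs0_normP[r r0 rU].
have r2 : 0 < r / 2 by rewrite divr_gt0.
have [A FA' AP] := FAl _ r2; apply: (@filterS _ F) FA' => a Aa.
rewrite -(subrK b a) addrC; apply: rU; apply: (@le_lt_trans _ _ (r / 2)).
  apply/c0_normP => [|n]; first exact: ltW.
  by rewrite c0_valB bl modulus_distC AP.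
by rewrite ltr_pdivrMr// ltr_pMr// ltr1n.
Qed.

End NullSequences.

HB.instance Definition _ (R : realType) (k : scalar_kind) :=
  Uniform_isComplete.Build (ell_space (leey 1%E) (null_sub R k))
    (@c0_complete R k).

Definition c0_banach (R : realType) (k : scalar_kind) :
  completeNormedModType (scalars R k) := ell_space (leey 1%E) (null_sub R k).

Section Polars.
Context {R : realType} {k : scalar_kind}.
Local Notation K := (scalars R k).

Lemma set_type_cvg (E : tvsType K) (A : set (weakstar_dual E))
    (u : nat -> set_type A) (l : set_type A) :
  (set_val (u n) : weakstar_dual E) @[n --> \oo] --> (set_val l : weakstar_dual E) <->
  u @ \oo --> l.
Proof.
split=> [ul U|]; last first.
  move=> ul W Wl; apply: (ul (set_val @^-1` W)).
  exact: (@initial_continuous (set_type A) (weakstar_dual E) set_val l W Wl).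
rewrite nbhsE => -[V [[W oW WV] Vl] VU].
have Wl : nbhs (set_val l : weakstar_dual E) W.
  by apply: open_nbhs_nbhs; split => //; move: Vl; rewrite -WV.
by apply: (@filterS _ (nbhs \oo)) (ul _ Wl) => n Wn; apply: VU; rewrite -WV.
Qed.

Lemma unit_seq_null n : @unit_seq R k n @ \oo --> (0 : K^o).
Proof.
apply/cvg_modulusP => e e0; exists n.+1 => // m /= nm.
by rewrite /unit_seq gtn_eqF// subrr modulus0.
Qed.

(** The polars are even sequentially compact for the weak-star topology.  Choose
points arbitrarily in the given open sets and let g be their limit along an
ultrafilter; there are countably many unit vectors, so a subsequence converges
to g on each of them, hence on finitely supported sequences, hence everywhere
by equicontinuity. *)
Lemma c0_polars : selectively_sequentially_pseudocompact_polars (c0 R k).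
Proof.
move=> U U0 V oV.
have /choice[x xV] : forall n, exists x, V n x.
  by move=> n; have [_ [x]] := oV n; exists x.
exists x => //.
have [r r0 rU] := nbhs0_normP U0.
pose q (a : c0 R k) : R := r^-1 * modulus (`|a| : K).
have cq : csnorm q by apply: csnorm_mul (csnorm_norm _); rewrite invr_ge0 ltW.
pose u n : weakstar_dual (c0 R k) := set_val (x n).
have uU n a : U a -> modulus (u n a) <= 1.
  move=> Ua; have : polar U (u n) by exact: (set_valP (x n)).
  by move=> /(_ a Ua); rewrite -modulusE -(@of_real1 R k) ler_of_real.
have uq n a : modulus (u n a) <= q a.
  apply: (csnorm_bound cq) => [|b qb]; first exact: linearP.
  by apply: uU; apply: rU; move: qb; rewrite /q mulrC ltr_pdivrMr// mul1r.
have [G [UG sG]] := @ultraFilterLemma nat (nbhs \oo) _.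
have PG : ProperFilter G by exact: ultra_proper.
have [f [lf uf fq]] : exists f : c0 R k -> K^o, [/\ linear f,
    forall a, u n a @[n --> G] --> f a & forall a, modulus (f a) <= q a].
  apply: ultra_linear_lim => [t|a]; first exact: linearP.
  by apply: sG; apply: (@filterE _ (nbhs \oo)) => n /=; exact: uq.
have [g gf] := csnorm_dual cq lf fq.
have gU : polar U (g : weakstar_dual _).
  move=> a Ua; have -> : polar_dual_fun (g : weakstar_dual _) a = f a by exact: gf.
  rewrite -modulusE -(@of_real1 R k) ler_of_real -[f a]subr0.
  apply: (cvg_modulus_le PG (uf a)); apply: sG; apply: (@filterE _ (nbhs \oo)) => n /=.
  by rewrite subr0; exact: uU.
have /choice[e eE] : forall i, exists b : c0 R k, \val b = @unit_seq R k i.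
  by move=> i; apply: c0_build; exact: unit_seq_null.
have [m N|s si sP] := @extract_subseq (fun m n => forall i : 'I_m,
    modulus (f (e i) - u n (e i)) < m.+1%:R^-1).
  have GN : G [set n | (N <= n)%N] by apply: sG; exists N.
  have GP : G [set n | forall i : 'I_m, modulus (f (e i) - u n (e i)) < m.+1%:R^-1].
    apply: (@filter_forall _ _
      (fun (i : 'I_m) n => modulus (f (e i) - u n (e i)) < m.+1%:R^-1)) => i.
    by have /cvg_modulusP := uf (e i); apply; rewrite invr_gt0.
  by have [n [/= Nn Pn]] := filter_ex (filterI GN GP); exists n.
exists s => //; exists (SigSub (mem_set gU)).
apply/set_type_cvg; apply/weakstar_cvgP => a.
rewrite [X in _ --> X](_ : _ = f a); last exact: gf.
have ue i : u (s n) (e i) @[n --> \oo] --> f (e i).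
  apply/cvg_modulusP => d d0; have := near_infty_natSinv_lt (PosNum d0).
  move=> /= nd; near=> n.
  have iN : (i < n)%N by near: n; exact: nbhs_infty_gt.
  by apply: lt_trans (sP n (Ordinal iN)) _; near: n.
(* truncations of a *)
pose t N := \sum_(i < N) \val a i *: e i.
have tE N n : \val (t N) n = if (n < N)%N then \val a n else 0.
  rewrite /t c0_val_sum.
  under eq_bigr => i _ do rewrite c0_valZ eE /unit_seq.
  case: ltnP => [nN|Nn].
    rewrite (bigD1 (Ordinal nN))//= eqxx mulr1 big1 ?addr0// => i /eqP iN.
    case: eqP => [ni|]; last by rewrite mulr0.
    by case: iN; apply: val_inj.
  rewrite big1// => i _; rewrite gtn_eqF ?mulr0//.
  exact: leq_trans (ltn_ord i) Nn.
have ut N : u (s n) (t N) @[n --> \oo] --> f (t N).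
  elim: N => [|N IH].
    rewrite /t big_ord0 -gf linear0; under eq_fun do rewrite linear0.
    exact: cvg_cst.
  have -> : t N.+1 = \val a N *: e N + t N by rewrite /t big_ord_recr addrC.
  rewrite lf; under eq_fun do rewrite linearP.
  by apply: cvgD IH; apply: cvgZl_tmp; exact: ue.
apply/cvg_modulusP => d d0.
(* q bounds both u (s n) and f, so truncating a costs d / 4 in each of them *)
have d4 : 0 < d / 4 by rewrite divr_gt0.
have rd4 : 0 < r * (d / 4) by rewrite mulr_gt0.
have /cvg_modulusP/(_ _ rd4)[N _ aN] := c0_null a.
have qa : q (a - t N) <= d / 4.
  rewrite /q mulrC ler_pdivrMr// mulrC; apply/c0_normP => [|n]; first exact: ltW.
  rewrite c0_valB tE; case: ltnP => [_|/aN]; first by rewrite subrr modulus0 ltW.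
  by rewrite sub0r modulusN subr0 => /ltW.
have /cvg_modulusP/(_ _ d4) := ut N.
apply: filterS => n lt.
have -> : f a = f (a - t N) + f (t N) by rewrite -!gf -linearD subrK.
have -> : polar_dual_fun (set_val (x (s n))) a = u (s n) (a - t N) + u (s n) (t N).
  by rewrite -linearD subrK.
rewrite opprD addrACA (le_lt_trans (ler_modulusD _ _))//.
have := ler_modulusD (f (a - t N)) (- u (s n) (a - t N)).
rewrite modulusN.
have := fq (a - t N); have := uq (s n) (a - t N).
move: lt qa; lra.
Unshelve. all: by end_near. Qed.

End Polars.

(** * Operators into the space of null sequences *)

Section OperatorsToC0.
Context {R : realType} {k : scalar_kind}.
Local Notation K := (scalars R k).

Lemma open_weakstar_gt (Z : tvsType K) (z : Z) :
  open [set g : weakstar_dual Z | 1 < modulus (g z)].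
Proof.
suff H (g : weakstar_dual Z) : 1 < modulus (g z) ->
    nbhs g [set h : weakstar_dual Z | 1 < modulus (h z)].
  by rewrite openE => g; exact: H.
move=> gz; apply/polar_nbhsP.
have d0 : 0 < (modulus (g z) - 1) / 2 by rewrite divr_gt0// subr_gt0.
exists [set z], (of_real ((modulus (g z) - 1) / 2)); split=> [||h /(_ z erefl)].
- exact: finite_set1.
- by rewrite -(@of_real0 R k) ltr_of_real.
rewrite -modulusE ler_of_real => gh /=.
have := ler_modulusD (g z - h z) (h z); rewrite subrK; lra.
Qed.

(** Choose a continuous seminorm q with q (z_n) >= 1 along a subsequence.  By
Hahn-Banach the open sets of functionals larger than 1 at z_n meet the polar of
a ball of q.  Pseudocompactness selects points of these open sets with a
weak-star convergent subsequence, and subtracting the limit l makes it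
weak-star null.  Since l (z_n) tends to 0, this subtraction costs at most 1 / 2
far enough along the sequence. *)
Lemma pseudocompact_polars_separate (Z : tvsType K) (z : nat -> Z) :
  selectively_sequentially_pseudocompact_polars Z ->
  (forall f : dual Z, f (z n) @[n --> \oo] --> (0 : K^o)) ->
  ~ (z @ \oo --> (0 : Z)) ->
  exists s (f : nat -> weakstar_dual Z) (q : Z -> R),
    [/\ strictly_increasing s, weakstar_null f, csnorm q,
      forall n y, modulus (f n y) <= q y &
      forall n, 1 / 2 <= modulus (f n (z (s n)))].
Proof.
move=> sspZ z0 /(contra_not (cvg0_csnormP z _).2) /existsNP[q /not_implyP[cq]].
move=> /not_near_subseq[s si sP].
have qz n : 1 <= q (z (s n)) by rewrite leNgt; apply/negP; exact: sP.
(* the polar of V consists of the functionals dominated by 2 q, which reach the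
   value 2 q (z (s n)) > 1 at z (s n) *)
pose V := [set y | q y < 1 / 2].
have V0 : nbhs 0 V by apply: csnorm_nbhs0 => //; rewrite divr_gt0.
pose q2 y := 2 * q y; have cq2 : csnorm q2 by exact: csnorm_mul.
have polarq (g : weakstar_dual Z) : polar V g <-> forall y, modulus (g y) <= q2 y.
  split=> [Vg y|gq y Vy].
    apply: (csnorm_bound cq2) => [|x qx]; first exact: linearP.
    rewrite -(@ler_of_real R k) modulusE of_real1; apply: Vg.
    by move: qx; rewrite /V/= /q2; lra.
  rewrite -modulusE -(@of_real1 R k) ler_of_real (le_trans (gq y))//.
  by move: Vy; rewrite /V/= /q2; lra.
pose U n : set (set_type (polar V)) :=
  [set g | 1 < modulus ((set_val g : weakstar_dual Z) (z (s n)))].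
have [n|g gU [t ti [l gl]]] := sspZ V V0 U.
  split.
    by exists [set g : weakstar_dual Z | 1 < modulus (g (z (s n)))] => //;
      exact: open_weakstar_gt.
  have [f fq fz] := hahn_banach (z (s n)) cq2.
  have Vf : polar V (f : weakstar_dual Z) by apply/polarq.
  exists (SigSub (mem_set Vf)); rewrite /U/= set_valE/=.
  rewrite [X in _ < X](_ : _ = q2 (z (s n))); last exact: fz.
  by have := qz n; rewrite /q2; lra.
pose h n : weakstar_dual Z := set_val (g n); pose l' : weakstar_dual Z := set_val l.
have hq n y : modulus (h n y) <= q2 y by move: y; apply/polarq; exact: (set_valP (g n)).
have lq y : modulus (l' y) <= q2 y by move: y; apply/polarq; exact: (set_valP l).
have hl y (e : R) : 0 < e -> \forall n \near \oo, modulus (h (t n) y - l' y) < e.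
  move=> e0; have /set_type_cvg/weakstar_cvgP/(_ y)/cvg_modulusP/(_ _ e0) := gl.
  by apply: (@filterS _ (nbhs \oo)) => n; rewrite modulus_distC.
have i2 : 0 < 1 / 2 :> R by rewrite divr_gt0.
have /cvg_modulusP/(_ _ i2)[N _ NP] := z0 l'.
have addNi : strictly_increasing (addn N) by move=> m n; rewrite ltn_add2l.
have tNi : strictly_increasing (t \o addn N) by exact: strictly_increasing_comp.
have fE n y : ((h (t (N + n)%N) - l' : weakstar_dual Z) : Z -> K^o) y =
    h (t (N + n)%N) y - l' y by [].
(* dropping N terms makes l' smaller than 1 / 2 on the remaining points *)
exists (s \o t \o addn N), (fun n => h (t (N + n)%N) - l' : weakstar_dual Z),
  (fun y => 2 * q2 y); split.
- exact: (strictly_increasing_comp si tNi).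
- apply/weakstar_nullP => y e e0.
  have := near_subseq addNi (hl y e e0); apply: (@filterS _ (nbhs \oo)) => n.
  by rewrite fE.
- exact: csnorm_mul.
- move=> n y; rewrite fE (le_trans (ler_modulusD _ _))// modulusN.
  by have := hq (t (N + n)%N) y; have := lq y; lra.
- move=> n; rewrite fE /=; set m := t (N + n)%N.
  have := gU m; rewrite /U/= -/(h m) => gm.
  have /NP : (N <= s m)%N.
    apply: leq_trans (strictly_increasing_ge m si).
    by apply: leq_trans (strictly_increasing_ge _ ti); exact: leq_addr.
  rewrite /= sub0r modulusN => lm.
  have := ler_modulusD (h m (z (s m)) - l' (z (s m))) (l' (z (s m))).
  by rewrite subrK; move: gm lm; lra.
Qed.

Context {p : \bar R} (p1 : (1 <= p)%E) {E L : tvsType K} (T : operator E L).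

Lemma weakly_p_summable_image (x : nat -> E) (Z : tvsType K) (S : operator L Z)
    (f : dual Z) : weakly_p_summable p x ->
  f ((S \o T) (x n)) @[n --> \oo] --> (0 : K^o).
Proof.
move=> xp; apply: (p_summable_null p1).
exact: (xp (operator_comp f (operator_comp S T))).
Qed.

Lemma weakstar_p_convergent_pseudocompact (Z : tvsType K) (S : operator L Z) :
  weakstar_p_convergent p T -> selectively_sequentially_pseudocompact_polars Z ->
  p_convergent p (S \o T).
Proof.
move=> Tp sspZ x xp; apply: contrapT => nx.
have [s [f [q [si f0 _ _ fz]]]] := pseudocompact_polars_separate sspZ
  (fun g => weakly_p_summable_image S g xp) nx.
pose g n : weakstar_dual L := operator_comp (f n) S.
have g0 : weakstar_null g.
  by apply/weakstar_nullP => y e e0; exact: ((weakstar_nullP f).1 f0 (S y) e e0).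
have := Tp g (x \o s) g0 (weakly_p_summable_subseq p1 si xp).
have i2 : 0 < 1 / 2 :> R by rewrite divr_gt0.
move=> /cvg_modulusP/(_ _ i2)[N _ /(_ N (leqnn N))].
rewrite sub0r modulusN => lt; have := fz N.
by rewrite leNgt => /negP; apply; exact: lt.
Qed.

(** The separating functionals on Z are the coordinates of one operator from Z to
c_0, so testing against c_0 suffices. *)
Lemma c0_convergent_pseudocompact (Z : tvsType K) (S : operator L Z) :
  (forall S0 : operator L (c0 R k), p_convergent p (S0 \o T)) ->
  selectively_sequentially_pseudocompact_polars Z ->
  p_convergent p (S \o T).
Proof.
move=> Tp sspZ x xp; apply: contrapT => nx.
have [s [f [q [si f0 cq fq fz]]]] := pseudocompact_polars_separate sspZ
  (fun g => weakly_p_summable_image S g xp) nx.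
have [S0 S0E] := c0_operator f0 cq fq.
have := Tp (operator_comp S0 S) x xp.
have i2 : 0 < 1 / 2 :> R by rewrite divr_gt0.
move=> /cvg0_normP/(_ _ i2)[N _ /(_ (s N) (strictly_increasing_ge N si))].
move=> lt; have := fz N; rewrite leNgt => /negP; apply.
apply: le_lt_trans lt; rewrite -[X in modulus X](S0E (S (T (x (s N)))) N).
exact: c0_coord.
Qed.

(** In a c_0-barrelled space a weak-star null sequence is dominated by one
seminorm, and |f_n (T x_n)| is at most the norm in c_0 of the image of T x_n. *)
Lemma c0_convergent_weakstar : c0_barrelled L ->
  (forall S0 : operator L (c0 R k), p_convergent p (S0 \o T)) ->
  weakstar_p_convergent p T.
Proof.
move=> Lb Tp f x f0 xp.
have : nbhs (0 : L) [set y | forall n, modulus (f n y) < 1].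
  have E1 : entourage [set ab : K^o * K^o | `|ab.1 - ab.2| < 1].
    by rewrite -entourage_ballE; exists 1 => //=; rewrite -ball_normE.
  have := Lb f f0 0 _ E1; apply: (@filterS _ (nbhs (0 : L))) => y fy n.
  have := fy n I; rewrite /= linear0 sub0r normrN -modulusE -(@of_real1 R k).
  by rewrite ltr_of_real.
move=> /nbhs_csnorm[q cq qf].
have fq n y : modulus (f n y) <= q y.
  apply: (csnorm_bound cq) => [|z /qf/(_ n)/ltW//]; exact: linearP.
have [S0 S0E] := c0_operator f0 cq fq.
have /cvg0_normP H := Tp S0 x xp.
apply/cvg_modulusP => e e0; apply: filterS (H e e0) => n; rewrite sub0r modulusN.
by apply: le_lt_trans; rewrite -[X in modulus X](S0E (T (x n)) n); exact: c0_coord.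
Qed.

End OperatorsToC0.

(** * Operators on finitely supported sequences *)

Section SeriesOperators.
Context {R : realType} {k : scalar_kind}.
Local Notation K := (scalars R k).

(** A limited operator on a normed space makes weak-star null sequences small
uniformly on the unit ball, in particular on the diagonal. *)
Lemma limited_map_units (E L : tvsType K) (X : normedModType K)
    (T : operator E L) (S : operator X E) (u : nat -> X)
    (f : nat -> weakstar_dual L) : limited_map (T \o S) ->
  (forall n, modulus (`|u n| : K) <= 1) -> weakstar_null f ->
  f n (T (S (u n))) @[n --> \oo] --> (0 : K^o).
Proof.
move=> [U /nbhs0_normP[r r0 rU] /limitedP[_ H]] u1 f0.
apply/cvg_modulusP => e e0.
have r2 : 0 < r / 2 by rewrite divr_gt0.
have re : 0 < r / 2 * (e / 2) by rewrite mulr_gt0// divr_gt0.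
apply: filterS (H f f0 _ re) => n fn; rewrite sub0r modulusN.
apply: (@le_lt_trans _ _ (e / 2)); last first.
  by rewrite ltr_pdivrMr// ltr_pMr// ltr1n.
rewrite -(ler_pM2l r2); apply: le_trans (fn (T (S (of_real (r / 2) *: u n))) _).
  by rewrite !linearZ modulusM modulus_of_real gtr0_norm.
exists (of_real (r / 2) *: u n) => //; apply: rU.
rewrite (csnormZ (csnorm_norm X)) modulus_of_real gtr0_norm//.
apply: (@le_lt_trans _ _ (r / 2 * 1)); first by rewrite ler_wpM2l// ltW.
by rewrite mulr1 ltr_pdivrMr// ltr_pMr// ltr1n.
Qed.

Lemma weakly_null_bounded (E : tvsType K) (x : nat -> E) (q : E -> R) :
  (forall f : dual E, f (x n) @[n --> \oo] --> (0 : K^o)) -> csnorm q ->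
  exists2 M, 0 <= M & forall n, q (x n) <= M.
Proof.
move=> x0 cq; have [f|M xM] := @weakly_bounded_csnorm R k E (range x) _ q cq.
  have /cvg_modulusP/(_ _ ltr01)[N _ NP] := x0 f.
  exists (1 + \sum_(i < N) modulus (f (x i))) => _ [n _ <-].
  have [nN|Nn] := ltnP n N.
    rewrite (bigD1 (Ordinal nN))//= addrCA lerDl addr_ge0// sumr_ge0// => i _.
    exact: modulus_ge0.
  have := NP n Nn; rewrite /= sub0r modulusN => /ltW/le_trans; apply.
  by rewrite lerDl sumr_ge0// => i _; exact: modulus_ge0.
exists (Num.max M 0) => [|n]; first by rewrite le_max lexx orbT.
by rewrite le_max xM//; exists n.
Qed.

Lemma absolutely_convex_sum (E : tvsType K) (C : set E) (x : nat -> E)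
    (a : nat -> K) n : absolutely_convex C -> (forall i, C (x i)) ->
  \sum_(i < n) modulus (a i) <= 1 -> C (\sum_(i < n) a i *: x i).
Proof.
move=> Cc Cx; elim: n a => [|n IH] a.
  move=> _; rewrite big_ord0; have := Cc (x 0%N) (x 0%N) 0 0 (Cx _) (Cx _).
  by rewrite !normr0 addr0 ler01 !scale0r addr0; apply.
rewrite !big_ord_recr/=; set s := \sum_(i < n) modulus (a i) => s1.
have s0 : 0 <= s by apply: sumr_ge0 => i _; exact: modulus_ge0.
have [s00|sn0] := eqVneq s 0.
  rewrite big1 ?add0r => [|i _]; last first.
    have : modulus (a i) = 0.
      apply/eqP; rewrite eq_le modulus_ge0 andbT -s00 /s (bigD1 i)//= lerDl.
      by apply: sumr_ge0 => j _; exact: modulus_ge0.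
    by move=> /modulus0_eq0 ->; rewrite scale0r.
  have := Cc (x n) (x n) (a n) 0 (Cx _) (Cx _); rewrite scale0r addr0; apply.
  rewrite normr0 addr0 -modulusE -(@of_real1 R k) ler_of_real.
  by move: s1; rewrite s00 add0r.
have {sn0}s0' : 0 < s by rewrite lt_neqAle eq_sym sn0.
have sn0 : of_real s != 0 :> K.
  by rewrite -(@of_real0 R k) (inj_eq (@of_real_inj R k)) gt_eqF.
have -> : \sum_(i < n) a i *: x i =
    of_real s *: \sum_(i < n) ((of_real s)^-1 * a i) *: x i.
  by rewrite scaler_sumr; apply: eq_bigr => i _; rewrite scalerA mulVKf.
apply: Cc => //.
  apply: (IH (fun i => (of_real s)^-1 * a i)).
  under eq_bigr do rewrite modulusM.
  rewrite -mulr_sumr -/s.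
  have -> : modulus (of_real s : K)^-1 = s^-1.
    have : modulus ((of_real s)^-1 * of_real s : K) = 1 by rewrite mulVf ?modulus1.
    rewrite modulusM modulus_of_real gtr0_norm// => /(canRL (mulfK _)) ->.
      by rewrite mul1r.
    by rewrite gt_eqF.
  by rewrite mulVf// gt_eqF.
by rewrite -!modulusE -of_realD -(@of_real1 R k) ler_of_real modulus_of_real gtr0_norm.
Qed.

Lemma unit_span_supp (a : nat -> K^o) : unit_span a ->
  exists N, forall i, (N <= i)%N -> a i = 0.
Proof.
move=> [N [c ->]]; exists N => i Ni; rewrite fct_sumE big1// => j _.
by rewrite !fctE /unit_seq gtn_eqF ?scaler0//; exact: leq_trans Ni.
Qed.

Lemma ell1_0_supp (a : ell1_0 R k) :
  exists N, forall i, (N <= i)%N -> \val a i = 0.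
Proof. by apply: unit_span_supp; have /asboolP := valP a. Qed.

Lemma ell1_0_sum_le (a : ell1_0 R k) n :
  \sum_(i < n) modulus (\val a i) <= modulus (`|a| : K).
Proof.
have /(ell_space_normP a) := lexx (modulus (`|a| : K)).
move=> /(ell_norm_leP _ (lexx 1) (modulus_ge0 _))/(_ n).
rewrite powRr1 ?modulus_ge0// /power_sum; apply: le_trans.
by apply: ler_sum => i _; rewrite powRr1// modulus_ge0.
Qed.

Lemma ell1_0_unit n : exists2 u : ell1_0 R k, \val u = @unit_seq R k n &
  modulus (`|u| : K) <= 1.
Proof.
have um : @unit_seq R k n \in ell_sub_pred (unit_span_sub R k).
  apply/asboolP; exists n.+1, (fun i => (i == n)%:R).
  rewrite big_ord_recr/= eqxx scale1r big1 ?add0r// => i _.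
  by rewrite ltn_eqF// scale0r.
exists (Sub (@unit_seq R k n) um : ell_space (lexx 1%E) (unit_span_sub R k)) => //.
apply/ell_space_normP/ell_norm_leP => // N; rewrite powR1.
exact: power_sum_unit.
Qed.

(** Continuity of this map comes from the boundedness of weakly null sequences. *)
Lemma ell1_0_operator (E : tvsType K) (x : nat -> E) :
  (forall f : dual E, f (x n) @[n --> \oo] --> (0 : K^o)) ->
  exists S : operator (ell1_0 R k) E, forall a N,
    (forall i, (N <= i)%N -> \val a i = 0) -> S a = \sum_(i < N) \val a i *: x i.
Proof.
move=> x0; have /choice[N NP] := ell1_0_supp.
pose S a := \sum_(i < N a) \val a i *: x i.
have SE a M : (forall i, (M <= i)%N -> \val a i = 0) ->
    S a = \sum_(i < M) \val a i *: x i.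
  move=> aM; rewrite /S.
  rewrite (big_ord_widen _ (fun i => \val a i *: x i) (leq_maxl (N a) M)).
  rewrite [RHS](big_ord_widen _ (fun i => \val a i *: x i) (leq_maxr (N a) M)).
  rewrite big_mkcond [RHS]big_mkcond/=; apply: eq_bigr => i _.
  case: ltnP => [_|/NP ->]; case: ltnP => [_|/aM a0] //;
    by rewrite ?a0 ?scale0r.
have lS : linear S.
  move=> c a b; pose M := maxn (N a) (N b).
  have aM i : (M <= i)%N -> \val a i = 0.
    by rewrite geq_max => /andP[/NP].
  have bM i : (M <= i)%N -> \val b i = 0.
    by rewrite geq_max => /andP[_ /NP].
  have vE i : \val (c *: a + b) i = c * \val a i + \val b i by [].
  rewrite (SE a M)// (SE b M)// (SE _ M) => [|i Mi].
    rewrite scaler_sumr -big_split; apply: eq_bigr => i _.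
    by rewrite vE scalerDl scalerA.
  by rewrite vE aM// bM// mulr0 addr0.
have cS : continuous S.
  apply: linear_continuous_csnorm => // U /nbhs_csnorm[q cq qU].
  have [M M0 xM] := weakly_null_bounded x0 cq.
  exists (fun a => M * modulus (`|a| : K)).
    by apply: csnorm_mul => //; exact: csnorm_norm.
  move=> a aM; apply: qU; apply: le_lt_trans aM.
  apply: le_trans (csnorm_sum cq _ _ _) _.
  apply: (@le_trans _ _ (\sum_(i < N a) M * modulus (\val a i))).
    apply: ler_sum => i _.
    by rewrite (csnormZ cq) mulrC ler_wpM2r// modulus_ge0.
  by rewrite -mulr_sumr ler_wpM2l// ell1_0_sum_le.
by exists (Sub S (operator_mem lS cS)).
Qed.

(** The operator that sends the unit vectors to x maps the unit ball into the
absolutely convex hull of the range of x, which is precompact by hypothesis. *)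
Lemma ell1_0_limited_weakstar (p : \bar R) (E L : tvsType K) (T : operator E L) :
  (1 <= p)%E -> weakly_seq_locally_p_complete p E ->
  (forall Q : operator (ell1_0 R k) E,
    weakly_seq_p_precompact_map p Q -> limited_map (T \o Q)) ->
  weakstar_p_convergent p T.
Proof.
move=> p1 Ep H f x f0 xp.
have [S SE] := ell1_0_operator (fun g => p_summable_null p1 (xp g)).
have /H TS : weakly_seq_p_precompact_map p S.
  exists [set a | modulus (`|a| : K) < 1].
    exact: (csnorm_nbhs (csnorm_norm (ell1_0 R k))).
  move=> y yS; apply: (Ep x xp) => n.
  have [a /= a1 <-] := yS n.
  have [N aN] := ell1_0_supp a.
  rewrite (SE _ _ aN) => C [[_ Cc] xC].
  apply: (@absolutely_convex_sum E C x (\val a) N) => //.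
    by move=> i; apply: xC; exists i.
  exact: le_trans (ell1_0_sum_le _ _) (ltW a1).
have /choice[u uP] : forall n, exists u : ell1_0 R k,
    \val u = @unit_seq R k n /\ modulus (`|u| : K) <= 1.
  by move=> n; have [u uE u1] := ell1_0_unit n; exists u.
have Su n : S (u n) = x n.
  rewrite (SE _ n.+1) => [|i ni]; last first.
    by rewrite (uP n).1 /unit_seq gtn_eqF.
  rewrite big_ord_recr/= (uP n).1 /unit_seq eqxx scale1r big1 ?add0r// => i _.
  by rewrite ltn_eqF// scale0r.
have := limited_map_units TS (fun n => (uP n).2) f0.
by under eq_fun do rewrite Su.
Qed.

End SeriesOperators.

(** * Operators on the spaces of summable sequences *)

Section SeriesInSequenceSpaces.
Context {R : realType} {k : scalar_kind}.
Local Notation K := (scalars R k).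

Section Series.
Context {E : tvsType K} {r s : R} (r0 : 0 < r) (s0 : 0 < s)
  (rs : r^-1 + s^-1 = 1) {x : nat -> E}
  (xr : forall f : dual E, exists M, forall N,
    power_sum r (fun n => f (x n) : K^o) N <= M).

(** By Young's inequality the combinations of the x_i with coefficients in the unit
ball of l_s form a weakly bounded set, which is bounded by Mackey's theorem;
the rest is homogeneity.  This is where a property of each functional becomes
uniform over an equicontinuous set. *)
Lemma ell_combination_bounded (q : E -> R) : csnorm q ->
  exists2 M, 0 < M & forall (c : nat -> K^o) (d : R) n, 0 < d ->
    power_sum s c n <= d `^ s -> q (\sum_(i < n) c i *: x i) <= M * d.
Proof.
move=> cq; pose B := [set y | exists (c : nat -> K^o) n,
  power_sum s c n <= 1 /\ y = \sum_(i < n) c i *: x i].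
have [f|M BM] := @weakly_bounded_csnorm R k E B _ q cq.
  have [M fM] := xr f; exists (M / r + 1 / s) => _ [c [n [c1 ->]]].
  rewrite linear_sum; apply: le_trans (modulus_sum _ _ _) _.
  apply: (@le_trans _ _ (\sum_(i < n) (modulus (f (x i)) `^ r / r +
      modulus (c i) `^ s / s))).
    apply: ler_sum => i _; rewrite linearZ modulusM mulrC.
    by apply: conjugate_powR => //; exact: modulus_ge0.
  rewrite big_split/= -!mulr_suml lerD// ler_wpM2r ?invr_ge0 ?(ltW r0) ?(ltW s0)//.
  exact: fM.
exists (Num.max M 1) => [|c d n d0 cd]; first by rewrite lt_max ltr01 orbT.
have dn0 : of_real d != 0 :> K.
  by rewrite -(@of_real0 R k) (inj_eq (@of_real_inj R k)) gt_eqF.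
have -> : \sum_(i < n) c i *: x i =
    of_real d *: \sum_(i < n) (of_real d^-1 * c i) *: x i.
  rewrite scaler_sumr; apply: eq_bigr => i _.
  by rewrite scalerA mulrA -of_realM mulfV ?gt_eqF// of_real1 mul1r.
rewrite (csnormZ cq) modulus_of_real gtr0_norm// mulrC ler_pM2r//.
rewrite le_max BM//; exists (fun i => of_real d^-1 * c i), n; split=> //.
rewrite power_sumZ modulus_of_real gtr0_norm ?invr_gt0//.
rewrite -[d^-1](powR_inv1 (ltW d0)) -powRrM mulN1r powRN.
by rewrite mulrC ler_pdivrMr ?powR_gt0// mul1r.
Qed.

(** The partial sums are Cauchy: distant blocks of coefficients have small s-norm,
and ell_combination_bounded turns this into small values of each seminorm. *)
Lemma ell_operator (s1 : (1 <= s%:E)%E) : hausdorff_space E ->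
  sequentially_complete E -> exists S : operator (ell k s1) E,
    forall a : ell k s1, \sum_(i < n) \val a i *: x i @[n --> \oo] --> S a.
Proof.
move=> hE cE; pose y (a : ell k s1) n := \sum_(i < n) \val a i *: x i.
have yB q M (a : ell k s1) (d : R) m n : (m <= n)%N ->
    (forall (c : nat -> K^o) (d : R) n, 0 < d ->
      power_sum s c n <= d `^ s -> q (\sum_(i < n) c i *: x i) <= M * d) ->
    0 < d -> power_sum s (\val a) n - power_sum s (\val a) m <= d `^ s ->
    q (y a n - y a m) <= M * d.
  move=> mn qM d0; rewrite -power_sum_window// => /(qM _ _ _ d0).
  congr (q _ <= _); rewrite /y.
  rewrite -(big_mkord xpredT (fun i => (if (m <= i)%N then \val a i else 0) *: x i)).
  rewrite -!(big_mkord xpredT (fun i => \val a i *: x i)).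
  rewrite [in RHS](big_cat_nat (leq0n m) mn)/= addrAC subrr add0r.
  rewrite (big_cat_nat (leq0n m) mn)/= big_nat big1 ?add0r => [|i /andP[_ im]].
    by rewrite big_nat [RHS]big_nat; apply: eq_bigr => i /andP[-> _].
  by rewrite leqNgt im/= scale0r.
have yl a : exists l : E, y a @ \oo --> l.
  apply: cE => U /nbhs_csnorm[q cq qU].
  have [M M0 qM] := ell_combination_bounded cq.
  (* blocks of s-norm at most d have q-value at most M * d = 1 / 2 *)
  pose d := (2 * M)^-1; have d0 : 0 < d by rewrite invr_gt0 mulr_gt0.
  have ds0 : 0 < d `^ s by rewrite powR_gt0.
  have cv : cvgn (power_sum s (\val a)).
    apply: nondecreasing_is_cvgn; first by move=> m n; exact: power_sum_le.
    exists (modulus (`|a| : K) `^ s) => _ [N _ <-]; exact: ell_power_sum_le.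
  have /cvgrPdist_le/(_ _ ds0)[N _ NP] := cv.
  have pd m n : (N <= m)%N -> (m <= n)%N ->
      power_sum s (\val a) n - power_sum s (\val a) m <= d `^ s.
    move=> Nm mn; have := NP m Nm => /=.
    have : power_sum s (\val a) n <= limn (power_sum s (\val a)).
      apply: nondecreasing_cvgn_le => //.
      by move=> i j; exact: power_sum_le.
    have := ler_norm (limn (power_sum s (\val a)) - power_sum s (\val a) m); lra.
  have Md : M * d < 1.
    by rewrite /d invfM mulrCA mulfV ?gt_eqF// mulr1 invf_lt1// ltr1n.
  exists N => m n Nm Nn; apply: qU; apply: le_lt_trans Md.
  have [mn|/ltnW nm] := leqP m n.
    by rewrite (csnorm_distC cq); apply: yB => //; exact: pd.
  by apply: yB => //; exact: pd.
have [S SP] := choice yl.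
have lS : linear S.
  move=> c a b; apply: (cvg_unique hE (SP _)); apply/cvg_csnormP => q e cq e0.
  have e2 : 0 < e / 2 by rewrite divr_gt0.
  have ec : 0 < e / 2 / (modulus c + 1) by rewrite divr_gt0// ltr_wpDl ?modulus_ge0.
  have /cvg_csnormP/(_ q _ cq ec) Ha := SP a.
  have /cvg_csnormP/(_ q _ cq e2) Hb := SP b.
  apply: filterS2 Ha Hb => n Ha Hb.
  have -> : y (c *: a + b) n = c *: y a n + y b n.
    rewrite /y scaler_sumr -big_split; apply: eq_bigr => i _.
    rewrite (_ : \val (c *: a + b) i = c * \val a i + \val b i)//.
    by rewrite scalerDl scalerA.
  rewrite opprD addrACA -scalerBr (le_lt_trans (csnormD cq _ _))// [e]splitr.
  rewrite ler_ltD// (csnormZ cq).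
  rewrite (@le_trans _ _ (modulus c * (e / 2 / (modulus c + 1))))//.
    by rewrite ler_wpM2l ?modulus_ge0// ltW.
  have c1 : 0 < modulus c + 1 by rewrite ltr_wpDl ?modulus_ge0.
  by rewrite mulrCA ler_piMr ?(ltW e2)// ler_pdivrMr// mul1r lerDl.
have cS : continuous S.
  apply: linear_continuous_csnorm => // U /nbhs_csnorm[q cq qU].
  have [M M0 qM] := ell_combination_bounded cq.
  pose d := (2 * M)^-1; have d0 : 0 < d by rewrite invr_gt0 mulr_gt0.
  exists (fun a => (2 * M) * modulus (`|a| : K)).
    by apply: csnorm_mul; [rewrite mulr_ge0// ltW|exact: csnorm_norm].
  move=> a ad; apply: qU.
  have {}ad : modulus (`|a| : K) <= d.
    by rewrite /d -[leRHS]mul1r ler_pdivlMr ?mulr_gt0// mulrC ltW.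
  have h2 : 0 < 1 / 2 :> R by rewrite divr_gt0.
  have /cvg_csnormP/(_ q _ cq h2) Ha := SP a.
  have [n Han] := filter_ex Ha.
  rewrite -(subrK (y a n) (S a)) (le_lt_trans (csnormD cq _ _))//.
  have : q (y a n) <= M * d.
    apply: qM => //; apply: le_trans (ell_power_sum_le _ _) _.
    by rewrite le_powR ?modulus_ge0// ltW.
  have -> : M * d = 1 / 2 by rewrite /d invfM mulrCA mulfV ?gt_eqF// mulr1 mul1r.
  by move: Han; lra.
by exists (Sub S (operator_mem lS cS)) => a; exact: (SP a).
Qed.

End Series.

Lemma ell_limited_weakstar (r s : R) (s1 : (1 <= s%:E)%E) (E L : tvsType K)
    (T : operator E L) : 1 < r -> r^-1 + s^-1 = 1 ->
  hausdorff_space E -> sequentially_complete E ->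
  (forall S : operator (ell k s1) E, limited_map (T \o S)) ->
  weakstar_p_convergent r%:E T.
Proof.
move=> r1 rs hE cE H f x f0 xp; have r0 : 0 < r := lt_trans ltr01 r1.
have s1' : 1 <= s by rewrite -lee_fin.
have s0 : 0 < s := lt_le_trans ltr01 s1'.
have xr (g : dual E) : exists M, forall N,
    power_sum r (fun n => g (x n) : K^o) N <= M.
  by apply/ell_memP; [exact: ltW|exact: (xp g)].
have [S SP] := ell_operator r0 s0 rs xr s1 hE cE.
have /choice[u uP] : forall n, exists u : ell k s1, \val u = @unit_seq R k n.
  move=> n; apply: ell_build; apply/ell_memP => //.
  by exists 1 => N; exact: power_sum_unit.
have u1 n : modulus (`|u n| : K) <= 1.
  apply/ell_space_normP/ell_norm_leP => // N.
  by rewrite powR1 uP; exact: power_sum_unit.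
have Su n : S (u n) = x n.
  apply: (cvg_unique hE (SP _)).
  apply: cvg_near_cst.
  exists n.+1 => // m /= nm; rewrite uP (bigD1 (Ordinal nm))//= big1 ?addr0.
    by rewrite /unit_seq eqxx scale1r.
  move=> i /eqP im; rewrite /unit_seq; case: eqP => [ni|]; last by rewrite scale0r.
  by case: im; exact: val_inj.
have := limited_map_units (H S) u1 f0.
by under eq_fun do rewrite Su.
Qed.
End SeriesInSequenceSpaces.

(** * Weak compactness of the unit ball *)

Section EllBall.
Context {R : realType} {k : scalar_kind}.
Local Notation K := (scalars R k).
Context {r s : R} (r1 : 1 < r) (s1 : 1 <= s) (rs : r^-1 + s^-1 = 1).

Let r0 : 0 < r. Proof. exact: lt_trans ltr01 r1. Qed.
Let s0 : 0 < s. Proof. exact: lt_le_trans ltr01 s1. Qed.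

(** The converse of Hoelder's inequality.  With A the r-power sum of d, the bound is
tested on the weights of modulus |d_j|^(r - 1) / A^(1 / s) whose phase
cancels that of d_j: their s-power sum is 1 because (r - 1) s = r. *)
Lemma power_sum_duality (d : nat -> K^o) (C : R) :
  (forall (w : nat -> K^o) m, power_sum s w m <= 1 ->
    modulus (\sum_(j < m) w j * d j) <= C) ->
  forall m, power_sum r d m <= C `^ r.
Proof.
move=> dC m.
have C0 : 0 <= C.
  have := dC (fun=> 0) 0%N; rewrite /power_sum !big_ord0 modulus0; apply.
  exact: ler01.
have [->|A0] := eqVneq (power_sum r d m) 0; first exact: powR_ge0.
set A := power_sum r d m in A0 *.
have {}A0 : 0 < A by rewrite lt_neqAle eq_sym A0 power_sum_ge0.
have /choice[u uP] : forall j : nat, exists c : K, modulus c = 1 /\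
    c * d j = of_real (modulus (d j)).
  by move=> j; have [c c1 cd] := @unit_modulus_polar R k (d j); exists c.
pose w j : K^o := u j * of_real (modulus (d j) `^ (r - 1) * A `^ (- s^-1)).
have rs1 : (r - 1) * s = r.
  have sn0 : s != 0 by rewrite gt_eqF.
  have rn0 : r != 0 by rewrite gt_eqF.
  have : (r^-1 + s^-1) * (r * s) = r * s by rewrite rs mul1r.
  rewrite mulrDl mulKf// [r * s]mulrC mulKf// => e; rewrite mulrBl mul1r -mulrC.
  by rewrite -e addrAC subrr add0r.
have w1 : power_sum s w m <= 1.
  rewrite /power_sum (eq_bigr (fun j : 'I_m => modulus (d j) `^ r / A)).
    by rewrite -mulr_suml mulfV// gt_eqF.
  move=> j _; rewrite /w modulusM (uP j).1 mul1r modulus_of_real ger0_norm.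
    rewrite powRM ?powR_ge0// -!powRrM rs1 mulNr mulVf ?gt_eqF//.
    by rewrite powR_inv1// ltW.
  by rewrite mulr_ge0 ?powR_ge0.
have := dC _ _ w1.
have -> : \sum_(j < m) w j * d j = of_real (A `^ r^-1).
  have -> : A `^ r^-1 = A `^ (- s^-1) * A.
    rewrite -[X in _ * X](powRr1 (ltW A0)) -powRD; last by rewrite (gt_eqF A0) implybT.
    by congr powR; rewrite -rs addrC addrK.
  rewrite /A /power_sum mulr_sumr (big_morph of_real (@of_realD R k) (@of_real0 R k)).
  apply: eq_bigr => j _; rewrite /w mulrAC (uP j).2 -of_realM; congr of_real.
  rewrite mulrA mulrC; congr (_ * _).
  by rewrite mulr_powRB1// modulus_ge0.
rewrite modulus_of_real ger0_norm ?powR_ge0// => AC.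
have -> : A = (A `^ r^-1) `^ r by rewrite -powRrM mulVf ?gt_eqF// powRr1// ltW.
by rewrite le_powR ?powR_ge0.
Qed.

Lemma ell_norm_sum I (l : seq I) (F : I -> nat -> K^o) :
  (ell_norm s%:E (\sum_(j <- l) F j)%R <= \sum_(j <- l) ell_norm s%:E (F j))%E.
Proof.
elim: l => [|j l IH].
  rewrite !big_nil; apply/ell_norm_leP => // N; rewrite /power_sum big1 ?powR_ge0//.
  by move=> i _; rewrite modulus0 powR0// gt_eqF.
rewrite !big_cons; apply: le_trans (ell_normD _ _ _) _; first by rewrite lee_fin.
exact: leeD2l.
Qed.

Lemma near_power_sum T (G : set_system T) (a : T -> nat -> K^o) (l : nat -> K^o) N d :
  Filter G -> (forall i, a t i @[t --> G] --> l i) -> 0 < d ->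
  \forall t \near G, power_sum s (fun i => a t i - l i) N <= d.
Proof.
move=> FG al d0; pose e := d / N.+1%:R.
have e0 : 0 < e by rewrite divr_gt0.
have es0 : 0 < e `^ s^-1 by rewrite powR_gt0.
have : \forall t \near G, forall i : 'I_N, modulus (l i - a t i) < e `^ s^-1.
  apply: (@filter_forall _ _ (fun (i : 'I_N) t => modulus (l i - a t i) < e `^ s^-1)).
  by move=> i; have /cvg_modulusP := al i; exact.
apply: filterS => t ti; apply: (@le_trans _ _ (\sum_(i < N) e)).
  apply: ler_sum => i _; rewrite modulus_distC.
  have -> : e = (e `^ s^-1) `^ s by rewrite -powRrM mulVf ?gt_eqF// powRr1// ltW.
  by rewrite le_powR ?modulus_ge0 ?powR_ge0// ltW.
rewrite sumr_const card_ord -mulr_natr /e -mulrA ler_piMr ?(ltW d0)//.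
by rewrite mulrC ler_pdivrMr// mul1r ler_nat.
Qed.

Definition restrict (P : pred nat) (a : nat -> K^o) : nat -> K^o :=
  fun i => if P i then a i else 0.

Lemma power_sum_restrict P a N : power_sum s (restrict P a) N <= power_sum s a N.
Proof.
apply: ler_sum => i _; rewrite /restrict; case: ifP => // _.
by rewrite modulus0 powR0 ?powR_ge0// gt_eqF.
Qed.

Lemma power_sum_restrict_lt M a N :
  power_sum s (restrict (fun i => i < M)%N a) N <= power_sum s a M.
Proof.
have [NM|/ltnW MN] := leqP N M.
  exact: le_trans (power_sum_restrict _ _ _) (power_sum_le _ _ NM).
rewrite /power_sum -!(big_mkord xpredT (fun i => modulus (_ i) `^ s)).
rewrite (big_cat_nat (leq0n M) MN)/= [X in _ + X]big_nat [X in _ + X]big1 ?addr0.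
  apply: ler_sum => i _; rewrite /restrict; case: ifP => // _.
  by rewrite modulus0 powR0 ?powR_ge0// gt_eqF.
by move=> i /andP[Mi _]; rewrite /restrict ltnNge Mi modulus0 powR0// gt_eqF.
Qed.

(** On the first N coordinates, l is within distance 1 of some a_t. *)
Lemma coordinate_limit_norm T (G : set_system T) (a : T -> nat -> K^o)
    (l : nat -> K^o) : ProperFilter G ->
  (forall i, a t i @[t --> G] --> l i) ->
  (forall t, (ell_norm s%:E (a t) <= 1)%E) -> (ell_norm s%:E l <= 2%:E)%E.
Proof.
move=> PG al a1; apply/ell_norm_leP => // N.
have [t /= tN] := filter_ex (near_power_sum N _ al ltr01).
pose P := fun i => (i < N)%N.
have -> : power_sum s l N = power_sum s (restrict P l) N.
  by apply: eq_bigr => i _; rewrite /restrict /P ltn_ord.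
have : (ell_norm s%:E (restrict P l) <= 2%:E)%E.
  have -> : restrict P l = restrict P (a t) + (- 1) *: restrict P (fun i => a t i - l i).
    apply/funext => i; rewrite /restrict !fctE; case: ifP => _.
      by rewrite scaleN1r opprB addrC subrK.
    by rewrite scaler0 addr0.
  have sE : (1 <= s%:E)%E by rewrite lee_fin.
  apply: le_trans (ell_normD _ _ sE) _.
  have h1 : (ell_norm s%:E (restrict P (a t)) <= 1)%E.
    apply/ell_norm_leP => // M; apply: le_trans (power_sum_restrict _ _ _) _.
    by move: M; apply/ell_norm_leP.
  have h2 : (ell_norm s%:E ((- 1) *: restrict P (fun i => (a t i - l i)%R)) <= 1)%E.
    apply/ell_norm_leP => // M.
    rewrite (_ : power_sum _ _ _ =
        power_sum s (restrict P (fun i => a t i - l i)) M); last first.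
      by apply: eq_bigr => i _; rewrite !fctE scaleN1r modulusN.
    by rewrite powR1; apply: le_trans (power_sum_restrict_lt _ _ _) tN.
  by rewrite -[2](natrD _ 1 1) EFinD; exact: leeD.
by move=> /(ell_norm_leP _ s1 (ltW _)); apply.
Qed.

(** At each coordinate at most one summand is nonzero. *)
Lemma power_sum_disjoint (u : nat -> nat -> K^o) (w : nat -> K^o) m N :
  (forall i j j', u j i != 0 -> u j' i != 0 -> j = j') ->
  power_sum s (\sum_(j < m) w j *: u j) N <=
  \sum_(j < m) modulus (w j) `^ s * power_sum s (u j) N.
Proof.
move=> disj; rewrite /power_sum.
under [leRHS]eq_bigr do rewrite mulr_sumr.
rewrite exchange_big/=; apply: ler_sum => i _.
have -> : (\sum_(j < m) w j *: u j) i = \sum_(j < m) w j * u j i :> K.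
  by rewrite fct_sumE.
have [[j uj]|nu] := pselect (exists j : 'I_m, u j i != 0).
  rewrite (bigD1 j)//= big1 ?addr0 => [|j' /eqP jj'].
    rewrite (bigD1 j)//= modulusM powRM ?modulus_ge0// lerDl.
    by rewrite sumr_ge0// => j' _; rewrite mulr_ge0 ?powR_ge0.
  have [->|uj'] := eqVneq (u j' i) 0; first by rewrite mulr0.
  by case: jj'; apply/val_inj/(disj i).
rewrite big1 => [|j _].
  rewrite modulus0 powR0 ?gt_eqF// sumr_ge0// => j _.
  by rewrite mulr_ge0 ?powR_ge0.
have [->|uj] := eqVneq (u j i) 0; first by rewrite mulr0.
by case: nu; exists j.
Qed.

Lemma power_sum_tail (a : nat -> K^o) (C d : R) : 0 < d ->
  (forall N, power_sum s a N <= C) ->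
  exists N, forall M n, (N <= n)%N -> power_sum s a M - power_sum s a n <= d.
Proof.
move=> d0 aC; have cv : cvgn (power_sum s a).
  apply: nondecreasing_is_cvgn; first by move=> m n; exact: power_sum_le.
  by exists C => _ [N _ <-]; exact: aC.
have /cvgrPdist_le/(_ _ d0)[N _ NP] := cv.
exists N => M n Nn; have := NP n Nn => /=.
have : power_sum s a M <= limn (power_sum s a).
  by apply: nondecreasing_cvgn_le => // i j; exact: power_sum_le.
have := ler_norm (limn (power_sum s a) - power_sum s a n); lra.
Qed.

Lemma power_sum_outside (a : nat -> K^o) (m n M : nat) d : (m <= n)%N ->
  power_sum s a m <= d ->
  (forall M', power_sum s a M' - power_sum s a n <= d) ->
  power_sum s (restrict (fun i => ~~ (m <= i < n)%N) a) M <= d + d.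
Proof.
move=> mn am an; pose M' := maxn M n.
have nM' : (n <= M')%N by exact: leq_maxr.
have mM' : (m <= M')%N by exact: leq_trans nM'.
apply: le_trans (power_sum_le s _ (leq_maxl M n)) _; rewrite -/M'.
apply: le_trans (lerD am (an M')); rewrite /power_sum.
rewrite -!(big_mkord xpredT (fun i => modulus (_ i) `^ s)).
rewrite [X in _ <= _ + (X - _)](big_cat_nat (leq0n n) nM')/= addrAC subrr add0r.
rewrite (big_cat_nat (leq0n m) mM')/= (big_cat_nat mn nM')/=.
have le i : modulus (restrict (fun i => ~~ (m <= i < n)%N) a i) `^ s <=
    modulus (a i) `^ s.
  by rewrite /restrict; case: ifP => // _; rewrite modulus0 powR0 ?powR_ge0// gt_eqF.
rewrite lerD//; first by apply: ler_sum => i _.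
rewrite [X in X + _]big_nat [X in X + _]big1 ?add0r => [|i /andP[mi ni]].
  by apply: ler_sum => i _.
by rewrite /restrict mi ni/= modulus0 powR0// gt_eqF.
Qed.

Lemma sum_half_powers m : \sum_(j < m) (2^-1 : R) ^+ j <= 2.
Proof.
have -> : \sum_(j < m) (2^-1 : R) ^+ j = 2 - 2 * 2^-1 ^+ m.
  elim: m => [|m IH]; first by rewrite big_ord0 expr0 mulr1 subrr.
  by rewrite big_ord_recr/= IH exprS; field.
by rewrite gerBl mulr_ge0// exprn_ge0.
Qed.

(** Pairs (n_j, N_j) are chosen so that b_(n_(j+1)) is tiny on the coordinates
before N_j, and then N_(j+1) so that it is tiny after N_(j+1).  Its restriction
to the window [N_j, N_(j+1)) has norm at most 3, and the windows are disjoint,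
so these parts contribute at most 3; the remainders have norm at most 2^-j and
contribute at most 2. *)
Lemma gliding_hump (G : set_system nat) (b : nat -> nat -> K^o) :
  ProperFilter G -> nbhs \oo `<=` G ->
  (forall i, b n i @[n --> G] --> (0 : K^o)) ->
  (forall n, (ell_norm s%:E (b n) <= 3%:E)%E) ->
  exists2 t, strictly_increasing t & forall (w : nat -> K^o) m,
    power_sum s w m <= 1 ->
    (ell_norm s%:E (\sum_(j < m) w j *: b (t j))%R <= 5%:E)%E.
Proof.
move=> PG sG b0 b3.
have b3' n N : power_sum s (b n) N <= 3 `^ s by move: N; apply/ell_norm_leP.
pose h N : R := 2^-1 ^+ N.
have h0 N : 0 < h N by rewrite exprn_gt0.
(* half for the coordinates before the window, half for those after it *)
pose d N := h N `^ s / 2.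
have d0 N : 0 < d N by rewrite divr_gt0// powR_gt0.
have [_ sg|sg sgP _] := @extract_chain (nat * nat)
    (fun x y => [/\ (x.1 < y.1)%N, (x.2 < y.2)%N,
      power_sum s (b y.1) x.2 <= d x.2 &
      forall M, power_sum s (b y.1) M - power_sum s (b y.1) y.2 <= d x.2])
    (fun _ _ => True) (0, 0)%N.
  have G1 : G [set n | (sg.1 < n)%N] by apply: sG; exists sg.1.+1.
  have [n [/= n1 n2]] := filter_ex (filterI G1 (near_power_sum sg.2 _ b0 (d0 sg.2))).
  have [N NP] := power_sum_tail (d0 sg.2) (b3' n).
  exists (n, maxn N sg.2.+1) => //; split=> //=; first exact: leq_maxr.
    by apply: le_trans n2; apply: ler_sum => i _; rewrite subr0.
  by move=> M; apply: NP; exact: leq_maxl.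
pose N j := (sg j).2.
have Ninc : strictly_increasing N.
  by apply: strictly_increasing_step => j; have [] := sgP j.
exists (fun j => (sg j.+1).1).
  by apply: strictly_increasing_step => j; have [] := sgP j.+1.
move=> w m w1; pose c j := b (sg j.+1).1.
(* membership in the j-th window *)
pose P j i := (N j <= i < N j.+1)%N.
pose u j := restrict (P j) (c j).
pose v j := restrict (fun i => ~~ P j i) (c j).
have -> : \sum_(j < m) w j *: b (sg j.+1).1 =
    \sum_(j < m) w j *: u j + \sum_(j < m) w j *: v j.
  rewrite -big_split/=; apply: eq_bigr => j _; rewrite -scalerDr; congr (_ *: _).
  apply/funext => i; rewrite !fctE /u /v /restrict.
  by case: (P j i); rewrite ?addr0 ?add0r.
have sE : (1 <= s%:E)%E by rewrite lee_fin.
apply: le_trans (ell_normD _ _ sE) _.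
rewrite (_ : 5%:E = (3%:E + 2%:E)%E); last by rewrite -EFinD -natrD.
apply: leeD.
  apply/ell_norm_leP => // M; apply: le_trans (power_sum_disjoint _ _ _ _) _.
    have Pdisj i j j' : (j < j')%N -> P j i -> P j' i -> False.
      move=> jj' /andP[_ ij] /andP[ij' _].
      have : (N j.+1 <= N j')%N.
        by move: jj'; rewrite leq_eqVlt => /predU1P[->//|/Ninc/ltnW].
      by rewrite leqNgt (leq_ltn_trans ij' ij).
    move=> i j j'; rewrite /u /restrict.
    case: ifP => [Pj _|]; last by rewrite eqxx.
    case: ifP => [Pj' _|]; last by rewrite eqxx.
    by have [/Pdisj/(_ Pj Pj')|/Pdisj/(_ Pj' Pj)|] := ltngtP j j'.
  apply: (@le_trans _ _ (\sum_(j < m) modulus (w j) `^ s * 3 `^ s)).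
    apply: ler_sum => j _; rewrite ler_wpM2l ?powR_ge0//.
    exact: le_trans (power_sum_restrict _ _ _) (b3' _ _).
  by rewrite -mulr_suml ler_piMl ?powR_ge0.
apply: le_trans (ell_norm_sum _ _) _.
apply: (@le_trans _ _ (\sum_(j < m) (h j)%:E)%E); last first.
  by rewrite sumEFin lee_fin sum_half_powers.
apply: lee_sum => j _; apply/ell_norm_leP => //; first exact: ltW.
move=> M; rewrite [power_sum _ _ _]power_sumZ.
have wj : modulus (w j) `^ s <= 1.
  apply: le_trans w1; rewrite /power_sum (bigD1 j)//= lerDl.
  by apply: sumr_ge0 => i _; exact: powR_ge0.
apply: (@le_trans _ _ (1 * (h (N j) `^ s))).
  apply: ler_pM => //; rewrite ?powR_ge0 ?power_sum_ge0//.
  have [_ _ H1 H2] := sgP j.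
  have jN : (N j <= N j.+1)%N by apply/ltnW/Ninc.
  apply: le_trans (power_sum_outside _ jN H1 H2) _.
  by rewrite /d -splitr.
rewrite mul1r le_powR ?(ltW (h0 _))// /h.
have jN : (j <= N j)%N := strictly_increasing_ge j Ninc.
apply: ler_wiXn2l => //.
by rewrite invf_le1// ler1n.
Qed.

End EllBall.

Section EllBallCompact.
Context {R : realType} {k : scalar_kind}.
Local Notation K := (scalars R k).

(** Let l be the coordinatewise limit, along an ultrafilter, of a sequence a in the
unit ball.  By the gliding hump, a subsequence of a - l has bounded combinations
for coefficients in the unit ball of l_s.  Applying a functional f of E
composed with S and power_sum_duality gives the r-summability of its values. *)
Lemma ell_operator_compact (r s : R) (s1 : (1 <= s%:E)%E) (E : tvsType K)
    (S : operator (ell k s1) E) : 1 < r -> r^-1 + s^-1 = 1 ->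
  weakly_seq_p_compact_map r%:E S.
Proof.
move=> r1 rs; have s1' : 1 <= s by rewrite -lee_fin.
have s0 : 0 < s := lt_le_trans ltr01 s1'.
exists [set a | modulus (`|a| : K) < 1].
  exact: (csnorm_nbhs (csnorm_norm (ell k s1))).
move=> y yS; have /choice[a aP] : forall n, exists a : ell k s1,
    modulus (`|a| : K) < 1 /\ S a = y n.
  by move=> n; have [a a1 ay] := yS n; exists a.
have an n : (ell_norm s%:E (\val (a n)) <= 1)%E.
  by apply/ell_space_normP/ltW/(aP n).1.
have [G [UG sG]] := @ultraFilterLemma nat (nbhs \oo) _.
have PG : ProperFilter G by exact: ultra_proper.
have /choice[l al] : forall i, exists l : K^o, \val (a n) i @[n --> G] --> l.
  move=> i; apply: (ultra_cvg (M := 1) UG).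
  apply: sG; apply: (@filterE _ (nbhs \oo)) => n /=.
  have := (ell_norm_leP (\val (a n)) s1' ler01).1 (an n) i.+1.
  rewrite powR1 /power_sum big_ord_recr/=.
  have : 0 <= \sum_(j < i) modulus (\val (a n) j) `^ s.
    by apply: sumr_ge0 => j _; exact: powR_ge0.
  move=> h0 h1; rewrite -(le_powR s0) ?modulus_ge0// powR1.
  by apply: le_trans h1; rewrite lerDr.
have l2 := coordinate_limit_norm s1' PG al an.
have [l' l'E] : exists l' : ell k s1, \val l' = l.
  by apply: ell_build; apply: (le_lt_trans l2); exact: ltry.
have bE n : \val (a n - l') = (\val (a n) + (- 1) *: l).
  by apply/funext => i; rewrite -l'E !fctE scaleN1r.
have [|n|t ti tP] := @gliding_hump R k s s1' G (fun n => \val (a n - l')) PG sG.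
- move=> i; apply/cvg_modulusP => e e0.
  have /cvg_modulusP/(_ _ e0) := al i; apply: filterS => n.
  by rewrite bE sub0r modulusN !fctE scaleN1r modulus_distC.
- rewrite bE; apply: le_trans (ell_normD _ _ s1) _.
  rewrite -[3](natrD _ 1 2) EFinD; apply: leeD => //.
  rewrite ell_normZ//; last exact: le_lt_trans l2 (ltry _).
  by rewrite modulusN modulus1 mul1e.
exists t => //; exists (S l') => f.
have fS0 : linear (f \o S : ell k s1 -> K^o).
  by move=> c x z; rewrite /= !linearP.
have [rho rho0 frho] : exists2 rho : R, 0 < rho & forall x : ell k s1,
    modulus (`|x| : K) < rho -> modulus (f (S x)) < 1.
  have := csnorm_nbhs (csnorm_modulus (operator_comp f S)).
  by move=> /nbhs0_normP[rho rho0 H]; exists rho.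
have fS x : modulus (f (S x)) <= rho^-1 * modulus (`|x| : K).
  apply: (csnorm_bound (q := fun x : ell k s1 => rho^-1 * modulus (`|x| : K))
    (f := f \o S)) => //.
    by apply: csnorm_mul; [rewrite invr_ge0 ltW|exact: csnorm_norm].
  by move=> z; rewrite mulrC ltr_pdivrMr// mul1r => /frho/ltW.
rewrite p_summable_fin; apply/ell_memP; first exact: ltW.
exists ((rho^-1 * 5) `^ r); apply: (power_sum_duality r1 s1' rs) => w m w1.
have -> : \sum_(j < m) w j * f ((y \o t) j - S l') =
    f (S (\sum_(j < m) w j *: (a (t j) - l'))).
  have SE j : S (w j *: (a (t j) - l')) = w j *: ((y \o t) j - S l').
    rewrite -[(y \o t) j](aP (t j)).2 -[S _ - _]linearB; exact: linearZ_LR.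
  rewrite linear_sum (eq_bigr _ (fun (j : 'I_m) _ => SE j)).
  rewrite linear_sum; apply: eq_bigr => j _; exact/esym/linearZ_LR.
apply: le_trans (fS _) _; rewrite ler_wpM2l ?invr_ge0 ?(ltW rho0)//.
apply/ell_space_normP; apply: le_trans (tP w m w1).
rewrite (_ : \val (\sum_(j < m) _) = \sum_(j < m) w j *: \val (a (t j) - l'))//.
by elim/big_ind2: _ => // ? ? ? ? <- <-.
Qed.

End EllBallCompact.

(** * The equivalences *)

Lemma hoelder_conjugate_real (R : realType) (r : R) : 1 < r ->
  exists2 s : R, hoelder_conjugate r%:E = s%:E & r^-1 + s^-1 = 1.
Proof.
move=> r1; have r0 : 0 < r := lt_trans ltr01 r1.
have := @hoelder_conjugate_eq1 R r%:E (ltNyr r).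
rewrite eqe gt_eqF// => /(_ isT).
have : (1 <= hoelder_conjugate r%:E)%E.
  by apply: hoelder_conj_ge1; rewrite lee_fin ltW.
case E : (hoelder_conjugate r%:E) => [s||]//.
  rewrite lee_fin => s1; have s0 : 0 < s := lt_le_trans ltr01 s1.
  by rewrite !inver !gt_eqF// -EFinD => -[rs]; exists s.
by move=> _; have := hoelder_conjugate_eqy E => -[re]; move: r1; rewrite re ltxx.
Qed.

Theorem theorem3p12 (R : realType) (k : scalar_kind) (p : \bar R)
    (p1 : (1 <= p)%E) (E L : tvsType (scalars R k))
    (hausE : hausdorff_space E) (hausL : hausdorff_space L)
    (T : operator E L) :
  let i := weakstar_p_convergent p T in
  let ii := forall A : set E, A !=set0 ->
    weakly_seq_p_precompact p A -> limited (T @` A) in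
  let iii := forall A : set E, A !=set0 ->
    relatively_weakly_seq_p_compact p A -> limited (T @` A) in
  let iii' := forall A : set E, A !=set0 ->
    weakly_seq_p_compact p A -> limited (T @` A) in
  let iv := forall x : nat -> E,
    weakly_p_summable p x -> limited (T @` range x) in
  let v := forall Z : tvsType (scalars R k), hausdorff_space Z ->
    selectively_sequentially_pseudocompact_polars Z ->
    forall S : operator L Z, p_convergent p (S \o T) in
  let v' := forall Z : completeNormedModType (scalars R k),
    selectively_sequentially_pseudocompact_polars Z ->
    forall S : operator L Z, p_convergent p (S \o T) in
  let vi := forall S : operator L (c0 R k), p_convergent p (S \o T) in
  let vii := forall (X : normedModType (scalars R k)) (Q : operator X E),
    weakly_seq_p_precompact_map p Q -> limited_map (T \o Q) in
  let viii := forall (X : normedModType (scalars R k)) (Q : operator X E),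
    weakly_seq_p_precompact_map p Q ->
    p_convergent +oo%E
      (fun f : weakstar_dual L => adjoint Q (adjoint T f) : strong_dual X) in
  let ix := forall Q : operator (ell1_0 R k) E,
    weakly_seq_p_precompact_map p Q -> limited_map (T \o Q) in
  let x := forall (Z : normedModType (scalars R k)) (S : operator Z E),
    weakly_seq_p_compact_map p S -> limited_map (T \o S) in
  let xi := forall S : operator (ell k (hoelder_conj_ge1 p1)) E,
    limited_map (T \o S) in
  [/\ (i <-> ii) /\ (ii <-> iii) /\ (iii <-> iii') /\ (iii' <-> iv),
      (i -> v) /\ (v <-> v') /\ (v' -> vi) /\ (c0_barrelled L -> vi -> i),
      (ii -> vii) /\ (vii <-> viii) /\ (viii -> ix) /\
        (weakly_seq_locally_p_complete p E -> ix -> i) &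
      (1 < p < +oo)%E -> (iii -> x) /\ (x -> xi) /\
        (sequentially_complete E -> xi -> i)].
Proof.
move=> i ii iii iii' iv v v' vi vii viii ix x xi.
have i_ii : i -> ii.
  by move=> Ti A A0 Ap; exact: (weakstar_p_convergent_precompact Ti).
have ii_iii : ii -> iii.
  by move=> H A A0 Ap; apply: H => //; exact: relatively_compact_precompact.
have iii_iii' : iii -> iii'.
  by move=> H A A0 Ap; apply: H => //; exact: compact_relatively_compact.
have iii'_iv : iii' -> iv.
  move=> H y yp; have yA := p_summable_range_compact p1 yp.
  apply: (@limited_subset _ _ _ _ (T @` (range y `|` [set 0]))).
  - by exists (T (y 0%N)), (y 0%N) => //; exists 0%N.
  - by move=> _ [z yz <-]; exists z => //; left.
  - by apply: H => //; exists 0; right.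
have iv_i : iv -> i by exact: limited_ranges_weakstar_p_convergent.
have i_v : i -> v.
  by move=> Ti Z _ sspZ S; exact: weakstar_p_convergent_pseudocompact.
have v_v' : v -> v'.
  by move=> H Z sspZ S; apply: H => //; exact: norm_hausdorff.
have v'_vi : v' -> vi.
  by move=> H S; apply: (H (c0_banach R k)); exact: c0_polars.
(* (v') implies (v) by way of (vi) *)
have vi_v : vi -> v.
  by move=> H Z _ sspZ S; exact: c0_convergent_pseudocompact.
have vii_viii : vii -> viii.
  by move=> H X Q Qp; apply: limited_map_adjoint; exact: H.
have viii_vii : viii -> vii.
  by move=> H X Q Qp; apply: adjoint_limited_map; exact: H.
split.
- by split; [split; [|auto]|split; [split; [|auto]|split; split; auto]]; auto.
- split=> //; split; first by split=> // /v'_vi/vi_v.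
  by split=> //; exact: c0_convergent_weakstar.
- split=> [H X Q [U U0 QU]|].
    exists U => //; rewrite -image_comp; apply: H => //.
    by exists (Q 0), 0 => //; exact: nbhs_singleton.
  split=> //; split=> [/viii_vii H Q Qp|Ep H]; first exact: H.
  exact: (ell1_0_limited_weakstar p1 Ep).
move=> p1oo; have [r pE r1] : exists2 r, p = r%:E & 1 < r.
  by move: p1oo; case: (p) => [r|//|//] /andP[]; rewrite ?ltxx// lte_fin; exists r.
split=> [H Z S [U U0 SU]|].
  exists U => //; rewrite -image_comp; apply: H => //.
  by exists (S 0), 0 => //; exact: nbhs_singleton.
rewrite /x /xi /i; move: (hoelder_conj_ge1 p1).
have [s sE rs] := hoelder_conjugate_real r1.
rewrite pE sE => s1; split=> [H S|Ec H].
  by apply: H; exact: ell_operator_compact.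
exact: (ell_limited_weakstar r1 rs hausE Ec H).
Qed.
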